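(* Let $[\Lambda,q,r,\beta]$ and $[\Lambda,q,r,\beta']$ be two non-zero semisimple strata in $A=\mathrm{End}_F(V)$ which intertwine, with associated splittings $V=\bigoplus_{i\in I}V^i$ and $V=\bigoplus_{j\in I'}V'^j$, and let $\zeta:I\to I'$ be their matching. Put $\Lambda^i=\Lambda\cap V^i$ and $\Lambda'^{j}=\Lambda\cap V'^{j}$, and suppose that $$\dim_{\kappa_F}(\Lambda^i_j/\Lambda^i_{j+1})=\dim_{\kappa_F}(\Lambda'^{\zeta(i)}_j/\Lambda'^{\zeta(i)}_{j+1})\quad\text{for all }i\in I,\ j\in\mathbb Z.$$ Then the strata are conjugate by an element of $\tilde{\mathrm U}(\Lambda)$, i.e. there is $g\in\tilde{\mathrm U}(\Lambda)$ such that $[\Lambda,q,r,g\beta g^{-1}]$ is equivalent to $[\Lambda,q,r,\beta']$.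
   Context: $F$ nonarchimedean local field of odd residual characteristic, $o_F$, residue field $\kappa_F$, uniformizer $\pi$. $V$ finite-dimensional, $A=\mathrm{End}_F(V)$, $\tilde G=A^\times$. Lattice sequences $\Lambda$: decreasing maps $\mathbb Z\to$ full-rank $o_F$-lattices with $\Lambda_s\pi=\Lambda_{s+e}$ ($e$ = period). $\mathfrak a_n(\Lambda)=\{a:a\Lambda_s\subseteq\Lambda_{s+n}\forall s\}$, $\tilde{\mathrm U}(\Lambda)=\mathfrak a_0(\Lambda)^\times$, $\nu_\Lambda(a)=\sup\{n:a\in\mathfrak a_n\}$, normalizing: $\nu_\Lambda(g^{-1})=-\nu_\Lambda(g)$. Strata $[\Lambda,q,r,\beta]$ ($q\ge r\ge0$, $\beta\in\mathfrak a_{-q}$); equivalence: $\beta+\mathfrak a_{-r-j}(\Lambda)=\beta'+\mathfrak a_{-r'-j}(\Lambda')$ $\forall j\ge0$; intertwining: some $g\in\tilde G$ with $g(\beta+\mathfrak a_{-r}(\Lambda))g^{-1}\cap(\beta'+\mathfrak a_{-r'}(\Lambda'))\ne\emptyset$. Zero: $\beta=0,q=r$; pure: $F[\beta]$ a field, $F[\beta]^\times$ normalizes $\Lambda$, $\nu_\Lambda(\beta)=-q<-r$; simple: zero or pure with minimal $[F[\beta]:F]$ among equivalent pure strata; semisimple: zero, or $\nu_\Lambda(\beta)=-q<-r$ and there is a decomposition $V=\bigoplus_{i\in I}V^i$ (projections $1^i$, the associated splitting) with $1^i\beta1^j=0$ ($i\ne j$), $\Lambda_s=\bigoplus_i(\Lambda_s\cap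 V^i)$, each $[\Lambda^i,q_i,r,\beta_i]$ simple ($\beta_i=1^i\beta1^i$, $q_i=-\min\{\nu_\Lambda(\beta_i),-r\}$) and for $i\ne j$ $[\Lambda^i\oplus\Lambda^j,\max\{q_i,q_j\},r,\beta_i+\beta_j]$ not equivalent to any simple stratum. Matching: for two intertwining non-zero semisimple strata whose lattice sequences have the same period, the unique bijection $\zeta:I\to I'$ such that $[\Lambda^i\oplus\Lambda'^{\zeta(i)},\max\{q_i,q'_{\zeta(i)}\},r,\beta_i+\beta'_{\zeta(i)}]$ is equivalent to a simple stratum for every $i\in I$. *)

(* Defs.v *)
From HB Require Import structures.
From mathcomp Require Import all_boot all_order all_algebra.
Set Implicit Arguments. Unset Strict Implicit. Unset Printing Implicit Defensive.
Import Order.TTheory GRing.Theory Num.Theory.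
Local Open Scope ring_scope.

Section Defs.
Variables (F : fieldType) (v : F -> int) (pi : F).

(* "x has valuation >= N" (the valuation of 0 is +infinity; v 0 is irrelevant) *)
Definition vge (x : F) (N : int) : Prop := x = 0 \/ N <= v x.
Definition in_oF (x : F) : Prop := vge x 0.
Definition in_pF (x : F) : Prop := vge x 1.

Definition discrete_valuation : Prop :=
  [/\ forall x y, x != 0 -> y != 0 -> v (x * y) = v x + v y,
      forall x y, x != 0 -> y != 0 -> x + y != 0 ->
                  Num.min (v x) (v y) <= v (x + y),
      pi != 0 & v pi = 1].

Definition complete_valued : Prop :=
  forall u : nat -> F,
    (forall N : int, exists M : nat, forall m k, (M <= m)%N -> (M <= k)%N ->
        vge (u m - u k) N) ->
    exists l : F, forall N : int, exists M : nat, forall k, (M <= k)%N ->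
        vge (u k - l) N.

Definition finite_residue_field : Prop :=
  exists s : seq F, (forall x, x \in s -> in_oF x) /\
    (forall x, in_oF x -> exists2 y, y \in s & in_pF (x - y)).

(* odd residual characteristic: 2 is a unit of o_F, i.e. char kappa_F <> 2 *)
Definition odd_residual_char : Prop := (2 : F) != 0 /\ v 2 = 0.

Definition local_field : Prop :=
  [/\ discrete_valuation, complete_valued, finite_residue_field
    & odd_residual_char].

Definition in_oFv (d : nat) (c : 'cV[F]_d) : Prop := forall i, in_oF (c i 0).

Definition is_lattice (m : nat) (L : 'cV[F]_m -> Prop) (d : nat) : Prop :=
  exists B : 'M[F]_(m, d), \rank B = d /\
    forall x, L x <-> exists c : 'cV[F]_d, in_oFv c /\ x = B *m c.

(* lattice sequence (in the subspace it spans): decreasing, periodic *)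
Definition lattice_seq (m : nat) (Lam : int -> 'cV[F]_m -> Prop) : Prop :=
  [/\ exists d, forall s, is_lattice (Lam s) d,
      forall s x, Lam (s + 1) x -> Lam s x
    & exists e : int, 0 < e /\
        forall s x, Lam (s + e) x <-> exists y, Lam s y /\ x = pi *: y].

Definition full_lattice_seq (m : nat) (Lam : int -> 'cV[F]_m -> Prop) : Prop :=
  lattice_seq Lam /\ forall s, is_lattice (Lam s) m.

Definition aset (m : nat) (Lam : int -> 'cV[F]_m -> Prop) (k : int)
  (a : 'M[F]_m) : Prop := forall s x, Lam s x -> Lam (s + k) (a *m x).

Definition nu_is m (Lam : int -> 'cV[F]_m -> Prop) (a : 'M[F]_m) (k : int) :=
  aset Lam k a /\ ~ aset Lam (k + 1) a.

Definition in_Ut m (Lam : int -> 'cV[F]_m -> Prop) (g : 'M[F]_m) : Prop :=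
  [/\ g \in unitmx, aset Lam 0 g & aset Lam 0 (invmx g)].

Definition stratum m (Lam : int -> 'cV[F]_m -> Prop) (q r : int) (b : 'M[F]_m) :=
  [/\ lattice_seq Lam, 0 <= r, r <= q & aset Lam (- q) b].

Definition equiv_strata m (Lam : int -> 'cV[F]_m -> Prop) (q r : int) (b : 'M[F]_m)
  (Lam' : int -> 'cV[F]_m -> Prop) (q' r' : int) (b' : 'M[F]_m) : Prop :=
  forall (j : nat) (a : 'M[F]_m),
    aset Lam (- r - j%:Z) (a - b) <-> aset Lam' (- r' - j%:Z) (a - b').

Definition intertwine m (Lam : int -> 'cV[F]_m -> Prop) (q r : int) (b : 'M[F]_m)
  (Lam' : int -> 'cV[F]_m -> Prop) (q' r' : int) (b' : 'M[F]_m) : Prop :=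
  exists g : 'M[F]_m, g \in unitmx /\ exists a a',
    [/\ aset Lam (- r) a, aset Lam' (- r') a'
      & g *m (b + a) *m invmx g = b' + a'].

Definition zero_stratum m (q r : int) (b : 'M[F]_m) : Prop := b = 0 /\ q = r.

Definition peval m (b : 'M[F]_m) (p : {poly F}) : 'M[F]_m :=
  \sum_(i < size p) p`_i *: b ^+ i.

(* a and a' agree on W = span of Lam *)
Definition agree_on m (Lam : int -> 'cV[F]_m -> Prop) (a a' : 'M[F]_m) : Prop :=
  forall s x, Lam s x -> a *m x = a' *m x.

Definition gen_field m (Lam : int -> 'cV[F]_m -> Prop) (b : 'M[F]_m) : Prop :=
  (exists s x, Lam s x /\ x != 0) /\
  forall p : {poly F}, agree_on Lam (peval b p) 0 \/
    exists p' : {poly F}, agree_on Lam (peval b p' * peval b p) 1.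

Definition normalizes m (Lam : int -> 'cV[F]_m -> Prop) (b : 'M[F]_m) : Prop :=
  forall p : {poly F}, ~ agree_on Lam (peval b p) 0 ->
    exists k : int, forall s x,
      Lam (s + k) x <-> exists y, Lam s y /\ x = peval b p *m y.

(* [F[b]:F] = d (degree of the minimal polynomial of b on W) *)
Definition ext_degree m (Lam : int -> 'cV[F]_m -> Prop) (b : 'M[F]_m) (d : nat) :=
  (exists p : {poly F}, [/\ p \is monic, size p = d.+1 & agree_on Lam (peval b p) 0])
  /\ forall p : {poly F}, p \is monic -> agree_on Lam (peval b p) 0 -> (d < size p)%N.

Definition pure m (Lam : int -> 'cV[F]_m -> Prop) (q r : int) (b : 'M[F]_m) :=
  [/\ stratum Lam q r b, gen_field Lam b, normalizes Lam b,
      nu_is Lam b (- q) & - q < - r].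

Definition simple m (Lam : int -> 'cV[F]_m -> Prop) (q r : int) (b : 'M[F]_m) :=
  stratum Lam q r b /\
  (zero_stratum q r b \/
   (pure Lam q r b /\
    forall (Lam' : int -> 'cV[F]_m -> Prop) (q' r' : int) (c : 'M[F]_m),
      pure Lam' q' r' c -> equiv_strata Lam q r b Lam' q' r' c ->
      forall d d', ext_degree Lam b d -> ext_degree Lam' c d' -> (d <= d')%N)).

Definition restrict m (Lam : int -> 'cV[F]_m -> Prop) (P : 'M[F]_m) :
  int -> 'cV[F]_m -> Prop := fun s x => Lam s x /\ P *m x = x.

(* q_i = - min {nu(b_i), -r} *)
Definition qi_def m (Lam : int -> 'cV[F]_m -> Prop) (b : 'M[F]_m) (r q : int) :=
  (aset Lam (- r) b /\ q = r) \/ (nu_is Lam b (- q) /\ r < q).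

(* [Lam,q,r,b] is a non-zero semisimple stratum with associated splitting
   given by the projections P i (V^i = image of P i) *)
Definition semisimple_split n (Lam : int -> 'cV[F]_n -> Prop) (q r : int)
  (b : 'M[F]_n) (I : finType) (P : I -> 'M[F]_n) : Prop :=
  [/\ [/\ stratum Lam q r b, nu_is Lam b (- q) & - q < - r],
      [/\ forall i, P i != 0, forall i, P i * P i = P i,
          forall i j, i != j -> P i * P j = 0 & \sum_i P i = 1],
      forall i j, i != j -> P i * b * P j = 0,
      forall s x i, Lam s x -> Lam s (P i *m x)
    & exists qs : I -> int,
      [/\ forall i, qi_def (restrict Lam (P i)) (P i * b * P i) r (qs i),
          forall i, simple (restrict Lam (P i)) (qs i) r (P i * b * P i)
        & forall i j, i != j ->
            forall (L'' : int -> 'cV[F]_n -> Prop) q'' r'' (c : 'M[F]_n),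
              simple L'' q'' r'' c ->
              ~ equiv_strata (restrict Lam (P i + P j)) (Num.max (qs i) (qs j)) r
                  (P i * b * P i + P j * b * P j) L'' q'' r'' c]].

Definition extsum m (L1 L2 : int -> 'cV[F]_m -> Prop) : int -> 'cV[F]_(m + m) -> Prop :=
  fun s x => L1 s (usubmx x) /\ L2 s (dsubmx x).

Definition is_matching n (Lam : int -> 'cV[F]_n -> Prop) (r : int) (b : 'M[F]_n)
  (I : finType) (P : I -> 'M[F]_n)
  (Lam' : int -> 'cV[F]_n -> Prop) (b' : 'M[F]_n)
  (I' : finType) (P' : I' -> 'M[F]_n) (zeta : I -> I') : Prop :=
  bijective zeta /\
  forall i (qi qj : int),
    qi_def (restrict Lam (P i)) (P i * b * P i) r qi ->
    qi_def (restrict Lam' (P' (zeta i))) (P' (zeta i) * b' * P' (zeta i)) r qj ->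
    exists (L'' : int -> 'cV[F]_(n + n) -> Prop) q'' r'' (c : 'M[F]_(n + n)),
      simple L'' q'' r'' c /\
      equiv_strata (extsum (restrict Lam (P i)) (restrict Lam' (P' (zeta i))))
        (Num.max qi qj) r
        (block_mx (P i * b * P i) 0 0 (P' (zeta i) * b' * P' (zeta i)))
        L'' q'' r'' c.

(* dim_{kappa_F} (L / L') = k : existence of a kappa_F-basis of size k *)
Definition kdim m (L L' : 'cV[F]_m -> Prop) (k : nat) : Prop :=
  exists x : 'I_k -> 'cV[F]_m,
    [/\ forall t, L (x t),
        forall c : 'I_k -> F, (forall t, in_oF (c t)) ->
          L' (\sum_t c t *: x t) -> forall t, in_pF (c t)
      & forall y, L y -> exists c : 'I_k -> F,
          (forall t, in_oF (c t)) /\ L' (y - \sum_t c t *: x t)].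

End Defs.

(* Main.v *)
Require Import Defs.
From HB Require Import structures.
From mathcomp Require Import all_boot all_order all_algebra.
From mathcomp Require Import boolp zify ring.
Import Order.TTheory GRing.Theory Num.Theory.
Local Open Scope ring_scope.

(** Each matched pair of blocks is handled inside the simple stratum [L,q,r,c]
equivalent to their sum M = L^i + L'^j; both filtrations agree up to a shift.
Write E = F[c], p for the projection of M onto L^i, and say that f in F[X] is
good if p commutes with f(c) in the graded algebra of L.

Minimality of [E:F] makes every f good.  Otherwise let phi be a monic bad
polynomial of least degree.  If deg f, deg g < deg phi and fg = a phi + h, then
a phi has larger value than fg, since otherwise a phi, hence phi, would be
good; so K = F[X]/(phi) is a field valued by h |-> v(h(c)).  Expanding
[p, phi(c)] along dual bases of K bounds it below by [p, c]; as phi is bad, phi(c)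
must lie so deep that dropping it replaces c by an equivalent pure element of
degree deg phi < [E:F].

Hence the graded pieces of L^i and L'^j are graded E-spaces.  Having the same
dimensions over the residue field, they have homogeneous orthogonal E-bases of
equal degrees, and the E-linear map sending one basis to the other, followed by the
projection to L'^j, is an isometry L^i -> L'^j intertwining the two blocks
modulo a_{-r}.  The sum of these isometries is g. *)

Set Implicit Arguments.
Unset Strict Implicit.
Unset Printing Implicit Defensive.

(** * Maxima and linear subspaces *)

(** Only [p, c] in a_{-r} is known, and the product rule loses value as the degree grows, so graded
    commutation is not a formal consequence: minimality of [E:F] must enter. It enters through one
    constant mu, the greatest value of a monic polynomial of degree deg phi - 1, which governs two
    unrelated estimates. On one side let M_l be an orthogonal F-basis of K and g_l its dual for the
    form reading off the coefficient of X^(deg phi - 1). Then [p, phi(c)] is the sum of the g_l(c)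
    [p, c] M_l(c), and value(g_l) + value(M_l) >= mu; so the commutator has value at least mu - r,
    and badness of phi forces value(phi) >= mu - r. On the other side, multiplying f by X in K
    rather than in F[X] subtracts lambda phi, with lambda the top coefficient of f, and value(f) <=
    e v(lambda) + mu; so the two multiplications differ by an element of a_{-r} as soon as
    value(phi) >= mu - r. The image of p need not be stable under c, which is why an E-structure is
    available only on graded pieces. *)

Lemma int_has_max (S : int -> Prop) (M : int) :
  (exists s, S s) -> (forall s, S s -> s <= M) ->
  exists s, S s /\ forall t, S t -> t <= s.
Proof.
move=> [s0 S0] ub.
have hP : exists k : nat, `[< S (M - k%:Z) >].
  exists (absz (M - s0)); apply/asboolP.
  by have := ub _ S0 => h; suff -> : M - `|M - s0|%N%:Z = s0 by []; lia.
case: (ex_minnP hP) => k /asboolP Sk kmin.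
exists (M - k%:Z); split => // t St.
have /kmin : `[< S (M - `|M - t|%N%:Z) >].
  by apply/asboolP; suff -> : M - `|M - t|%N%:Z = t by []; have := ub _ St; lia.
by have := ub _ St; lia.
Qed.

Lemma nat_has_max (S : nat -> Prop) (M : nat) :
  (exists s, S s) -> (forall s, S s -> (s <= M)%N) ->
  exists s, S s /\ forall t, S t -> (t <= s)%N.
Proof.
move=> [s0 S0] ub.
have hP : exists k : nat, `[< S k >] by exists s0; apply/asboolP.
have hM k : `[< S k >] -> (k <= M)%N by move/asboolP/ub.
case: (ex_maxnP hP hM) => k /asboolP Sk kmax.
by exists k; split => // t St; apply: kmax; apply/asboolP.
Qed.

Section Subspace.
Variables (F : fieldType) (m : nat).
Implicit Types S : 'cV[F]_m -> Prop.

Definition subspace S :=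
  [/\ S 0, forall x y, S x -> S y -> S (x + y) & forall a x, S x -> S (a *: x)].

Lemma subspaceB S x y : subspace S -> S x -> S y -> S (x - y).
Proof.
by move=> [_ hD hZ] hx hy; apply: hD => //; rewrite -scaleN1r; apply: hZ.
Qed.

Lemma subspace_sum S (I : Type) (s : seq I) (Q : pred I) (f : I -> 'cV[F]_m) :
  subspace S -> (forall i, Q i -> S (f i)) -> S (\sum_(i <- s | Q i) f i).
Proof. by move=> [h0 hD _] h; apply: (big_ind S). Qed.

(** A matrix of maximal rank with rows in [S] spans [S]: adjoining a missed vector would raise the
    rank. *)
Lemma subspace_mx S : subspace S -> exists B : 'M[F]_m, forall x, S x <-> (x^T <= B)%MS.
Proof.
move=> hS; have [h0 hD hZ] := hS.
pose Q k := exists B : 'M[F]_m, \rank B = k /\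
  forall w : 'rV_m, (w <= B)%MS -> S w^T.
have Q0 : exists k, Q k.
  exists 0%N, 0; rewrite mxrank0; split=> // w; rewrite submx0 => /eqP ->.
  by rewrite trmx0.
have Qm k : Q k -> (k <= m)%N by move=> [B [<- _]]; apply: rank_leq_row.
have [k [[B [rB hB]] kmax]] := nat_has_max Q0 Qm.
exists B => x; split=> [Sx|/hB]; last by rewrite trmxK.
apply: contrapT => nx.
have /kmax : Q (\rank (B + x^T)%MS).
  exists (B + x^T)%MS; split=> // w /sub_addsmxP[[u1 u2] /= ->].
  rewrite linearD /=; apply: hD.
    by apply: hB; apply: submxMl.
  rewrite [u2]mx11_scalar mul_scalar_mx linearZ /= trmxK; exact: hZ.
rewrite -rB leqNgt => /negP; apply.
rewrite (ltn_leqif (mxrank_leqif_sup (addsmxSl B x^T))).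
by apply/negP=> h; apply: nx; apply: submx_trans h; apply: addsmxSr.
Qed.

(** Some column of the cokernel of a spanning matrix is nonzero at [x]; rescaled, it is the required
    form. *)
Lemma subspace_separate S x : subspace S -> ~ S x ->
  exists xi : 'rV[F]_m, (forall u, S u -> xi *m u = 0) /\ (xi *m x) 0 0 = 1.
Proof.
move=> /subspace_mx[B hB] /hB /negP; rewrite submxE => /eqP nz.
have [j hj] : exists j, (x^T *m cokermx B) 0 j != 0.
  apply: contrapT => h; apply: nz; apply/rowP => j; rewrite [RHS]mxE.
  by apply: contrapT => /eqP hj; apply: h; exists j.
have colE u : (col j (cokermx B))^T *m u = ((u^T *m cokermx B) 0 j)%:M.
  rewrite -[u in LHS]trmxK -trmx_mul colE mulmxA -colE [X in X^T]mx11_scalar.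
  by rewrite tr_scalar_mx mxE.
exists (((x^T *m cokermx B) 0 j)^-1 *: (col j (cokermx B))^T); split=> [u /hB|].
  by rewrite submxE -scalemxAl colE => /eqP ->; apply/matrixP => a1 a2; rewrite !mxE mul0rn mulr0.
by rewrite -scalemxAl colE mxE [X in _ * X]mxE eqxx mulr1n mulVf.
Qed.

(** Turns a map that is linear only on a subspace, such as one defined through chosen coordinates,
    into a matrix. *)
Lemma subspace_linear_mx S (k : nat) (g : 'cV[F]_m -> 'cV[F]_k) : subspace S ->
  (forall a x y, S x -> S y -> g (a *: x + y) = a *: g x + g y) ->
  exists G : 'M[F]_(k, m), forall x, S x -> G *m x = g x.
Proof.
move=> hS hg; have [B hB] := subspace_mx hS; have [h0 hD hZ] := hS.
have SB i : S (row i B)^T by apply/hB; rewrite trmxK row_sub.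
have g0 : g 0 = 0.
  by have := hg (-1) 0 0 h0 h0; rewrite scaler0 addr0 scaleN1r addNr.
have gsum (a : 'I_m -> F) (s : seq 'I_m) :
    g (\sum_(i <- s) a i *: (row i B)^T) = \sum_(i <- s) a i *: g (row i B)^T.
  elim: s => [|i s IH]; first by rewrite !big_nil.
  rewrite !big_cons hg ?IH //.
  by apply: subspace_sum => // j _; apply: hZ.
exists (pinvmx B *m \matrix_(i < m) (g (row i B)^T)^T)^T => x /hB xB.
apply: trmx_inj; rewrite trmx_mul trmxK mulmxA.
have {2}-> : x = \sum_i (x^T *m pinvmx B) 0 i *: (row i B)^T.
  apply: trmx_inj; rewrite -[LHS](mulmxKpV xB) mulmx_sum_row linear_sum.
  by apply: eq_bigr => i _; rewrite linearZ /= trmxK.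
rewrite gsum mulmx_sum_row linear_sum; apply: eq_bigr => i _.
by rewrite linearZ /= rowK.
Qed.
End Subspace.

(** * Valuations and filtrations *)

Section Valuation.
Variables (F : fieldType) (v : F -> int) (pi : F).
Hypothesis hv : discrete_valuation v pi.

Lemma val_M x y : x != 0 -> y != 0 -> v (x * y) = v x + v y.
Proof. by case: hv => h _ _ _; apply: h. Qed.
Lemma val_1 : v 1 = 0.
Proof. by apply: (addrI (v 1)); rewrite addr0 -val_M ?oner_neq0 // mulr1. Qed.
Lemma val_V x : x != 0 -> v x^-1 = - v x.
Proof.
move=> x0; have := val_M x0 (invr_neq0 x0); rewrite divff // val_1; lia.
Qed.
Lemma val_N1 : v (-1) = 0.
Proof.
have n1 : (-1 : F) != 0 by rewrite oppr_eq0 oner_neq0.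
by have := val_M n1 n1; rewrite mulrNN mulr1 val_1; lia.
Qed.
Lemma val_pi : v pi = 1. Proof. by case: hv. Qed.
Lemma pi_neq0 : pi != 0. Proof. by case: hv. Qed.
Lemma val_piX k : v (pi ^+ k) = k%:Z.
Proof.
elim: k => [|k IH]; first by rewrite expr0 val_1.
by rewrite exprS val_M ?expf_neq0 ?pi_neq0 // IH val_pi; lia.
Qed.
Lemma val_surj (k : int) : exists2 a, a != 0 & v a = k.
Proof.
case: k => k; first by exists (pi ^+ k); rewrite ?expf_neq0 ?pi_neq0 ?val_piX.
exists (pi ^+ k.+1)^-1; first by rewrite invr_eq0 expf_neq0 ?pi_neq0.
by rewrite val_V ?expf_neq0 ?pi_neq0 // val_piX; lia.
Qed.

Lemma vge0 N : vge v 0 N. Proof. by left. Qed.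
Lemma vgeD x y N : vge v x N -> vge v y N -> vge v (x + y) N.
Proof.
move=> [->|hx]; first by rewrite add0r.
move=> [->|hy]; first by rewrite addr0; right.
have [->|x0] := eqVneq x 0; first by rewrite add0r; right.
have [->|y0] := eqVneq y 0; first by rewrite addr0; right.
have [->|xy0] := eqVneq (x + y) 0; first by left.
by right; case: hv => _ h _ _; apply: le_trans (h _ _ x0 y0 xy0); rewrite le_min hx.
Qed.
Lemma vgeM x y N M : vge v x N -> vge v y M -> vge v (x * y) (N + M).
Proof.
move=> [->|hx]; first by rewrite mul0r; left.
move=> [->|hy]; first by rewrite mulr0; left.
have [->|x0] := eqVneq x 0; first by rewrite mul0r; left.
have [->|y0] := eqVneq y 0; first by rewrite mulr0; left.
by right; rewrite val_M //; lia.
Qed.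
Lemma vgeW x N M : M <= N -> vge v x N -> vge v x M.
Proof. by move=> h [->|hx]; [left|right; lia]. Qed.
Lemma vge_sum (I : Type) (s : seq I) (Q : pred I) (f : I -> F) N :
  (forall i, Q i -> vge v (f i) N) -> vge v (\sum_(i <- s | Q i) f i) N.
Proof.
by move=> h; apply: (big_ind (fun x => vge v x N)); [exact: vge0|move=> x y; exact: vgeD|].
Qed.
Lemma vge_val x N : x != 0 -> vge v x N -> N <= v x.
Proof. by move=> x0 [x00|//]; rewrite x00 eqxx in x0. Qed.
End Valuation.

Section LatticeFunctions.
Variables (F : fieldType) (v : F -> int) (pi : F).
Hypothesis hv : discrete_valuation v pi.

Definition fspan m (L : int -> 'cV[F]_m -> Prop) (x : 'cV[F]_m) : Prop :=
  exists s, L s x.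

(* the features of a lattice sequence of period e that survive restriction to
   the image of a projection and direct sums; the last clause says that linear
   forms are bounded, which makes the filtration Hausdorff *)
Record filtration m (e : int) (L : int -> 'cV[F]_m -> Prop) : Prop := Filtration {
  fil_e : 0 < e;
  fil0 : forall s, L s 0;
  filD : forall s x y, L s x -> L s y -> L s (x + y);
  filW : forall s t x, s <= t -> L t x -> L s x;
  filZ : forall s a x, a != 0 -> L s x -> L (s + e * v a) (a *: x);
  fil_form : forall xi : 'rV[F]_m, exists s, forall x, L s x ->
    vge v ((xi *m x) 0 0) 1 }.

Section One.
Variables (m : nat) (e : int) (L : int -> 'cV[F]_m -> Prop).
Hypothesis hL : filtration e L.

Lemma filN s x : L s x -> L s (- x).
Proof.
move=> h; have n1 : (-1 : F) != 0 by rewrite oppr_eq0 oner_neq0.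
by have := filZ hL n1 h; rewrite (val_N1 hv) mulr0 addr0 scaleN1r.
Qed.
Lemma filB s x y : L s x -> L s y -> L s (x - y).
Proof. by move=> hx hy; apply: (filD hL) => //; apply: filN. Qed.
Lemma fil_sum s (I : Type) (r : seq I) (Q : pred I) (f : I -> 'cV[F]_m) :
  (forall i, Q i -> L s (f i)) -> L s (\sum_(i <- r | Q i) f i).
Proof.
move=> h; apply: (big_ind (L s)) => //; first exact: (fil0 hL).
by move=> x y; apply: (filD hL).
Qed.
Lemma filZK s a x : a != 0 -> L (s + e * v a) (a *: x) <-> L s x.
Proof.
move=> a0; split; last exact: (filZ hL).
move/(filZ hL (invr_neq0 a0)); rewrite (val_V hv) // scalerA mulVf // scale1r.
by rewrite mulrN addrK.
Qed.
Lemma filZge s a x k : vge v a k -> L s x -> L (s + e * k) (a *: x).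
Proof.
have := fil_e hL => e0.
move=> [->|hk] hx; first by rewrite scale0r; apply: (fil0 hL).
have [->|a0] := eqVneq a 0; first by rewrite scale0r; apply: (fil0 hL).
by apply: (filW hL) (filZ hL a0 hx); rewrite lerD2l ler_pM2l.
Qed.
Lemma fil_oF s a x : in_oF v a -> L s x -> L s (a *: x).
Proof. by move=> ha hx; have := filZge ha hx; rewrite mulr0 addr0. Qed.
Lemma fil_pF s a x : in_pF v a -> L s x -> L (s + 1) (a *: x).
Proof.
move=> ha hx; have := filZge ha hx; rewrite mulr1; apply: (filW hL).
by have := fil_e hL; lia.
Qed.
Lemma fil_sep x : (forall s, L s x) -> x = 0.
Proof.
move=> h; apply: contrapT => nx.
have sub0 : subspace (fun y : 'cV[F]_m => y = 0).
  by split=> // [x1 y -> ->|a y ->]; rewrite ?addr0 ?scaler0.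
have [xi [_ hx]] := subspace_separate sub0 nx.
have [s hs] := fil_form hL xi.
have := hs _ (h s); rewrite hx => /(vge_val (oner_neq0 F)).
by rewrite (val_1 hv).
Qed.

Lemma fspan_subspace : subspace (fspan L).
Proof.
split; first by exists 0; apply: (fil0 hL).
  move=> x y [s hs] [t ht]; exists (Num.min s t).
  by apply: (filD hL); [apply: (filW hL) hs|apply: (filW hL) ht]; lia.
move=> a x [s hs]; have [->|a0] := eqVneq a 0.
  by exists 0; rewrite scale0r; apply: (fil0 hL).
by exists (s + e * v a); apply: (filZ hL).
Qed.

(** A form that kills [S] and equals 1 at [x] is constant on [x + S], but takes values of valuation
    at least 1 on a deep enough lattice. *)
Lemma fil_bounded S x : subspace S -> ~ S x ->
  exists s, forall u, S u -> ~ L s (x + u).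
Proof.
move=> hS nx; have [xi [xiS xix]] := subspace_separate hS nx.
have [s hs] := fil_form hL xi; exists s => u Su /hs.
rewrite mulmxDr mxE xix xiS // mxE addr0 => /(vge_val (oner_neq0 F)).
by rewrite (val_1 hv).
Qed.

(** The orders met by the coset [x + S] are bounded above, so a member of the coset attains the
    largest; this member is orthogonal to [S]. *)
Lemma best_approx S x : subspace S -> (forall u, S u -> fspan L u) ->
  fspan L x -> ~ S x ->
  exists u, S u /\ forall u' s, S u' -> L s (x + u') -> L s (x + u).
Proof.
move=> hS hSW [s0 hx] nx; have [s1 hs1] := fil_bounded hS nx.
have [h0 _ _] := hS.
pose T s := exists2 u, S u & L s (x + u).
have [s [[u Su Lu] smax]] : exists s, T s /\ forall t, T t -> t <= s.
  apply: (@int_has_max T s1); first by exists s0; exists 0; rewrite ?addr0.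
  move=> s [u Su Lu]; have [//|lt] := lerP s s1.
  by case: (hs1 u Su); apply: (filW hL) Lu; lia.
by exists u; split=> // u' t Su' Lt; apply: (filW hL) Lu; apply: smax; exists u'.
Qed.

Lemma ord_ex x : fspan L x -> x != 0 -> exists s, forall t, L t x <-> t <= s.
Proof.
move=> xW /eqP x0.
have hS : subspace (fun y : 'cV[F]_m => y = 0).
  by split=> // [x1 y -> ->|a y ->]; rewrite ?addr0 ?scaler0.
have [s1 hs1] := fil_bounded hS x0.
have [s [Ls smax]] : exists s, L s x /\ forall t, L t x -> t <= s.
  apply: (@int_has_max _ s1) => // s Lu; have [//|lt] := lerP s s1.
  by case: (hs1 0 erefl); rewrite addr0; apply: (filW hL) Lu; lia.
by exists s => t; split=> [/smax//|h]; apply: (filW hL) Ls.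
Qed.

(* successive approximation by a subspace reaches the target, as a best
   approximation could otherwise be improved *)
Lemma approx_full S (Q : 'cV[F]_m -> Prop) : subspace S ->
  (forall u, S u -> fspan L u /\ Q u) ->
  (forall x y, Q x -> Q y -> Q (x + y)) ->
  (forall x s, Q x -> L s x -> exists2 u, S u & L (s + 1) (x - u)) ->
  forall x, Q x -> fspan L x -> S x.
Proof.
move=> hS SW QD hap x Qx xW; apply: contrapT => nx.
have SWs u : S u -> fspan L u by move/SW=> [].
have [u [Su umax]] := best_approx hS SWs xW nx.
have nz : x + u != 0.
  apply/eqP => h; apply: nx; have -> : x = 0 - u by rewrite -h addrK.
  by apply: subspaceB => //; case: hS.
have [_ WD _] := fspan_subspace.
have [s hs] := ord_ex (WD _ _ xW (SW _ Su).1) nz.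
have [u2 Su2 Lu2] := hap (x + u) s (QD _ _ Qx (SW _ Su).2) ((hs s).2 (lexx s)).
have : L (s + 1) (x + u).
  by apply: (umax (u - u2)); [apply: subspaceB|rewrite addrA].
by move/hs; lia.
Qed.

(** The last level containing [x]. The default 0 is taken at the zero vector and outside the span,
    where no such level exists. *)
Definition ord x : int :=
  if pselect (exists s, forall t, L t x <-> t <= s) is left h then sval (cid h) else 0.

Lemma ordP x s : fspan L x -> x != 0 -> L s x <-> s <= ord x.
Proof.
move=> xW x0; rewrite /ord; case: pselect => [h|[]]; last exact: ord_ex.
exact: (svalP (cid h)).
Qed.

Lemma ord_scale a x : a != 0 -> fspan L x -> x != 0 ->
  ord (a *: x) = ord x + e * v a.
Proof.
move=> a0 xW x0; have y0 : a *: x != 0 by rewrite scaler_eq0 negb_or a0.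
have yW : fspan L (a *: x) by case: fspan_subspace => _ _; apply.
apply: le_anti; apply/andP; split.
  have := (ordP (ord (a *: x)) yW y0).2 (lexx _).
  rewrite -{1}(subrK (e * v a) (ord (a *: x))) => /(filZK _ _ a0).
  by move/(ordP _ xW x0); lia.
by apply/(ordP _ yW y0)/(filZK _ _ a0)/(ordP _ xW x0).
Qed.

Lemma asetW k l (a : 'M[F]_m) : l <= k -> aset L k a -> aset L l a.
Proof. by move=> h ha s x /ha; apply: (filW hL); lia. Qed.
Lemma asetD k (a b : 'M[F]_m) : aset L k a -> aset L k b -> aset L k (a + b).
Proof.
by move=> ha hb s x hx; rewrite mulmxDl; apply: (filD hL); [apply: ha|apply: hb].
Qed.
Lemma asetB k (a b : 'M[F]_m) : aset L k a -> aset L k b -> aset L k (a - b).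
Proof.
by move=> ha hb s x hx; rewrite mulmxBl; apply: filB; [apply: ha|apply: hb].
Qed.
Lemma aset0 k : aset L k 0.
Proof. by move=> s x _; rewrite mul0mx; apply: (fil0 hL). Qed.
Lemma asetN k (a : 'M[F]_m) : aset L k a -> aset L k (- a).
Proof. by move=> h; rewrite -(sub0r a); apply: asetB => //; apply: aset0. Qed.
Lemma aset_sum k (I : Type) (r : seq I) (Q : pred I) (f : I -> 'M[F]_m) :
  (forall i, Q i -> aset L k (f i)) -> aset L k (\sum_(i <- r | Q i) f i).
Proof.
move=> h; apply: (big_ind (aset L k)) => //; first exact: aset0.
by move=> x y; apply: asetD.
Qed.
Lemma asetM k l (a b : 'M[F]_m) : aset L k a -> aset L l b -> aset L (k + l) (a *m b).
Proof.
by move=> ha hb s x /hb/ha; rewrite -mulmxA addrAC addrA.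
Qed.
Lemma asetZ k (t : F) (a : 'M[F]_m) : t != 0 ->
  aset L k a -> aset L (k + e * v t) (t *: a).
Proof.
by move=> t0 ha s x /ha h; rewrite -scalemxAl addrA; apply: (filZ hL).
Qed.
End One.

Lemma lattice_form m (Lam : 'cV[F]_m -> Prop) d (xi : 'rV[F]_m) :
  is_lattice v Lam d -> exists N, forall x, Lam x -> vge v ((xi *m x) 0 0) N.
Proof.
move=> [B [_ hB]].
have [N hN] : exists N, forall i, vge v ((xi *m B) 0 i) N.
  have [f hf] : exists f : 'I_d -> int, forall i, vge v ((xi *m B) 0 i) (f i).
    by exists (fun i => v ((xi *m B) 0 i)); right.
  exists (- \sum_i `|f i|) => i; apply: (vgeW _ (hf i)).
  rewrite (bigD1 i) //=; have : 0 <= \sum_(j | j != i) `|f j| by apply: sumr_ge0.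
  by move: (\sum_(j | j != i) _) => S hS; lia.
exists N => x /hB[c [hc ->]]; rewrite mulmxA mxE; apply: (vge_sum hv) => i _.
by rewrite -(addr0 N); apply: (vgeM hv) (hN i) (hc i).
Qed.

Lemma lattice_seq_filtration m (L : int -> 'cV[F]_m -> Prop) :
  lattice_seq v pi L -> exists e, filtration e L.
Proof.
move=> [[d hd] hdec [e [e0 he]]].
have L0 s : L s 0.
  have [B [_ ->]] := hd s; exists 0; rewrite mulmx0; split=> // i.
  by rewrite mxE; left.
have LD s x y : L s x -> L s y -> L s (x + y).
  have [B [_ hB]] := hd s; rewrite !hB => -[c [hc ->]] [c' [hc' ->]].
  exists (c + c'); rewrite mulmxDr; split=> // i; rewrite mxE.
  exact: (vgeD hv) (hc i) (hc' i).
have LW s t x : s <= t -> L t x -> L s x.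
  move=> st; have -> : t = s + (absz (t - s))%:Z by lia.
  elim: (absz _) => [|k IH]; first by rewrite addr0.
  move=> h; apply: IH; apply: hdec; suff <- : s + k.+1%:Z = s + k%:Z + 1 by [].
  by lia.
have Lo s a x : in_oF v a -> L s x -> L s (a *: x).
  have [B [_ hB]] := hd s; rewrite !hB => ha [c [hc ->]].
  exists (a *: c); rewrite -scalemxAr; split=> // i; rewrite mxE.
  by have := vgeM hv ha (hc i); rewrite addr0.
have pi0 := pi_neq0 hv.
have Lpi s x : L (s + e) (pi *: x) <-> L s x.
  rewrite he; split=> [[y [hy /(scalerI pi0) ->]]//|hx]; by exists x.
have LpiX s k x : L (s + e * k%:Z) (pi ^+ k *: x) <-> L s x.
  elim: k s x => [|k IH] s x; first by rewrite expr0 scale1r mulr0 addr0.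
  have -> : s + e * k.+1%:Z = (s + e * k%:Z) + e by lia.
  by rewrite exprS -scalerA Lpi IH.
exists e; split=> //.
- move=> s a x a0 hx; case E : (v a) => [k|k].
    have -> : a *: x = pi ^+ k *: ((a / pi ^+ k) *: x).
      by rewrite scalerA mulrC divfK // expf_neq0.
    rewrite LpiX; apply: Lo => //; right.
    by rewrite (val_M hv) ?invr_neq0 ?expf_neq0 // (val_V hv) ?expf_neq0 // (val_piX hv) E subrr.
  apply: (LpiX _ k.+1 _).1; have -> : s + e * Negz k + e * k.+1%:Z = s by lia.
  rewrite scalerA; apply: Lo => //; right.
  by rewrite (val_M hv) ?expf_neq0 // (val_piX hv) E; lia.
(* As [k >= 1 - N], multiplying by [pi ^+ k] raises the bound [N] on [L 0] to the bound 1 on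
   [L (e * k)]. *)
- move=> xi; have [N hN] := lattice_form xi (hd 0).
  set k := absz (1 - N).
  exists (e * k%:Z) => x.
  have pk0 : pi ^+ k != 0 by rewrite expf_neq0.
  have -> : x = pi ^+ k *: ((pi ^+ k)^-1 *: x).
    by rewrite scalerA divff // scale1r.
  rewrite -[e * _]add0r LpiX => /hN h; rewrite -scalemxAr mxE.
  apply: (vgeW _ (vgeM hv (N := k%:Z) _ h)); first by lia.
  by right; rewrite (val_piX hv).
Qed.
End LatticeFunctions.

(** * Polynomials in a normalizing field generator *)

Section Peval.
Variable F : fieldType.

Lemma peval_horner_mx m (b : 'M[F]_m.+1) p : peval b p = horner_mx b p.
Proof.
rewrite -[p in RHS]coefK poly_def rmorph_sum /=; apply: eq_bigr => i _.
by rewrite linearZ /= rmorphXn /= horner_mx_X.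
Qed.

Variables (m : nat) (b : 'M[F]_m).
Implicit Types p q : {poly F}.

Lemma pevalD p q : peval b (p + q) = peval b p + peval b q.
Proof.
case: m b => [|k] c; first by rewrite [LHS]flatmx0 [RHS]flatmx0.
by rewrite !peval_horner_mx rmorphD.
Qed.
Lemma pevalZ a p : peval b (a *: p) = a *: peval b p.
Proof.
case: m b => [|k] c; first by rewrite [LHS]flatmx0 [RHS]flatmx0.
by rewrite !peval_horner_mx linearZ.
Qed.
Lemma pevalM p q : peval b (p * q) = peval b p *m peval b q.
Proof.
case: m b => [|k] c; first by rewrite [LHS]flatmx0 [RHS]flatmx0.
by rewrite !peval_horner_mx rmorphM.
Qed.
Lemma pevalC a : peval b a%:P = a%:M.
Proof.
case: m b => [|k] c; first by rewrite [LHS]flatmx0 [RHS]flatmx0.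
by rewrite !peval_horner_mx horner_mx_C.
Qed.
Lemma pevalX : peval b 'X = b.
Proof.
case: m b => [|k] c; first by rewrite [LHS]flatmx0 [RHS]flatmx0.
by rewrite !peval_horner_mx horner_mx_X.
Qed.
Lemma peval0 : peval b 0 = 0.
Proof. by rewrite /peval size_poly0 big_ord0. Qed.
Lemma peval1 : peval b 1 = 1%:M. Proof. exact: pevalC. Qed.
Lemma pevalN p : peval b (- p) = - peval b p.
Proof. by rewrite -scaleN1r pevalZ scaleN1r. Qed.
Lemma pevalB p q : peval b (p - q) = peval b p - peval b q.
Proof. by rewrite pevalD pevalN. Qed.
Lemma peval_sum (I : Type) (r : seq I) (Q : pred I) (f : I -> {poly F}) :
  peval b (\sum_(i <- r | Q i) f i) = \sum_(i <- r | Q i) peval b (f i).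
Proof. by apply: (big_morph (peval b)); [exact: pevalD|exact: peval0]. Qed.
Lemma pevalMC p q : peval b p *m peval b q = peval b q *m peval b p.
Proof. by rewrite -!pevalM mulrC. Qed.
Lemma peval_annihilator : exists2 p, p \is monic & peval b p = 0.
Proof.
case: m b => [|k] c; first by exists 1; rewrite ?monic1 // [LHS]flatmx0.
by exists (char_poly c); rewrite ?char_poly_monic // peval_horner_mx Cayley_Hamilton.
Qed.
End Peval.

Section FieldAction.
Variables (F : fieldType) (v : F -> int) (pi : F).
Hypothesis hv : discrete_valuation v pi.
Variables (m : nat) (e : int) (L : int -> 'cV[F]_m -> Prop).
Hypothesis hL : filtration v e L.
Variable c : 'M[F]_m.
Hypothesis c_field : gen_field L c.
Hypothesis c_norm : normalizes L c.
Implicit Types f g : {poly F}.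

Local Notation A f := (peval c f).
Local Notation W := (fspan L).
Definition nz f := ~ agree_on L (A f) 0.

Lemma nzP f : nz f -> exists f', agree_on L (A f' * A f) 1.
Proof. by case: c_field => _ /(_ f) []. Qed.

Lemma peval_span f x : W x -> W (A f *m x).
Proof.
move=> [s hx]; have [h|h] := pselect (agree_on L (A f) 0).
  by exists 0; rewrite (h s x hx) mul0mx; apply: (fil0 hL).
have [k hk] := c_norm h; exists (s + k); apply/hk; by exists x.
Qed.

Lemma exists_nonzero : exists x, W x /\ x != 0.
Proof. by case: c_field => [[s [x [hx x0]]] _]; exists x; split=> //; exists s. Qed.

Lemma nz_inj f x : nz f -> W x -> A f *m x = 0 -> x = 0.
Proof.
move=> /nzP[f' hf'] [s hx] h; have := hf' s x hx.
by rewrite mul1mx -mulmxE -mulmxA h mulmx0.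
Qed.

Definition similitude (k : int) f := forall s x, W x -> L (s + k) (A f *m x) <-> L s x.

Lemma similitude_ex f : nz f -> exists k, similitude k f.
Proof.
move=> nf; have [k hk] := c_norm nf; exists k => s x xW; split=> [|hx]; last first.
  by apply/hk; exists x.
move/hk => [y [hy /eqP]]; rewrite -subr_eq0 -mulmxBr => /eqP h.
suff /eqP : x - y = 0 by rewrite subr_eq0 => /eqP ->.
apply: (nz_inj nf) h; apply: subspaceB => //; first exact: (fspan_subspace hL).
by exists s.
Qed.

Lemma similitude_ord k f x : nz f -> similitude k f -> W x -> x != 0 ->
  ord L (A f *m x) = ord L x + k.
Proof.
move=> nf hk xW x0.
have y0 : A f *m x != 0 by apply: contra x0 => /eqP h; apply/eqP; apply: nz_inj h.
have yW := peval_span f xW.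
apply: le_anti; apply/andP; split.
  have := (ordP hv hL (ord L (A f *m x)) yW y0).2 (lexx _).
  have := hk (ord L (A f *m x) - k) x xW; rewrite subrK => -> /(ordP hv hL _ xW x0).
  by lia.
by apply/(ordP hv hL _ yW y0)/hk => //; apply/(ordP hv hL _ xW x0).
Qed.

(** The valuation of the field F[c], normalised by the shift that f(c) induces on [L]; the default 0
    is taken when f(c) vanishes on the span. *)
Definition value f : int :=
  if pselect (exists k, similitude k f) is left h then sval (cid h) else 0.

Lemma valueP f : nz f -> similitude (value f) f.
Proof.
move=> nf; rewrite /value; case: pselect => [h|[]]; first exact: (svalP (cid h)).
exact: similitude_ex.
Qed.

Lemma value_ord f x : nz f -> W x -> x != 0 -> ord L (A f *m x) = ord L x + value f.
Proof. by move=> nf; apply: similitude_ord => //; apply: valueP. Qed.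

Lemma value_aset f : nz f -> aset L (value f) (A f).
Proof. by move=> nf s x hx; apply/(valueP nf) => //; exists s. Qed.

Lemma value_up f (s : int) x : nz f -> L s x -> L (s + value f) (A f *m x).
Proof. by move=> nf; apply: value_aset. Qed.
Lemma value_down f (s : int) x : nz f -> W x -> L (s + value f) (A f *m x) -> L s x.
Proof. by move=> nf xW; apply: (valueP nf s xW).1. Qed.

Lemma value_ge f k : nz f -> aset L k (A f) <-> k <= value f.
Proof.
move=> nf; split=> [h|h]; last by apply: (asetW hL) (value_aset nf).
have [x [xW x0]] := exists_nonzero.
have /h := (ordP hv hL (ord L x) xW x0).2 (lexx _).
have y0 : A f *m x != 0 by apply: contra x0 => /eqP h0; apply/eqP; apply: nz_inj h0.
move/(ordP hv hL _ (peval_span f xW) y0); rewrite value_ord //; lia.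
Qed.

Lemma nzM f g : nz f -> nz g -> nz (f * g).
Proof.
move=> nf ng h; have [x [xW x0]] := exists_nonzero.
have [s hx] := xW; have := h s x hx; rewrite pevalM mul0mx -mulmxA => h0.
have := nz_inj nf (peval_span g xW) h0 => /(nz_inj ng xW) h1.
by rewrite h1 eqxx in x0.
Qed.

Lemma valueM f g : nz f -> nz g -> value (f * g) = value f + value g.
Proof.
move=> nf ng; have [x [xW x0]] := exists_nonzero.
have y0 : A g *m x != 0 by apply: contra x0 => /eqP h0; apply/eqP; apply: nz_inj h0.
have := value_ord (nzM nf ng) xW x0; rewrite pevalM -mulmxA value_ord //; last first.
  exact: peval_span.
by rewrite value_ord //; lia.
Qed.

Lemma nzC a : a != 0 -> nz a%:P.
Proof.
move=> a0 h; have [x [[s hx] x0]] := exists_nonzero.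
have := h s x hx; rewrite pevalC mul_scalar_mx mul0mx => /eqP.
by rewrite scaler_eq0 (negPf a0) (negPf x0).
Qed.

Lemma valueC a : a != 0 -> value a%:P = e * v a.
Proof.
move=> a0; have [x [xW x0]] := exists_nonzero.
have := value_ord (nzC a0) xW x0; rewrite pevalC mul_scalar_mx.
by rewrite (ord_scale hv hL a0 xW x0); lia.
Qed.

Lemma valueZ a f : a != 0 -> nz f -> value (a *: f) = e * v a + value f.
Proof. by move=> a0 nf; rewrite -mul_polyC valueM ?valueC //; apply: nzC. Qed.

Lemma nzZ a f : a != 0 -> nz f -> nz (a *: f).
Proof. by move=> a0 nf; rewrite -mul_polyC; apply: nzM => //; apply: nzC. Qed.

(** Ultrametric principle: a perturbation of strictly larger value changes neither nonvanishing nor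
    value. *)
Lemma value_sub_eq f g : nz f -> aset L (value f + 1) (A f - A g) ->
  nz g /\ value g = value f.
Proof.
move=> nf h.
have ng : nz g.
  move=> h0; have : aset L (value f + 1) (A f).
    by move=> s x hx; have := h s x hx; rewrite mulmxBl (h0 s x hx) mul0mx subr0.
  by move/(value_ge _ nf); lia.
split=> //; apply: le_anti; apply/andP; split; last first.
  apply/(value_ge _ ng); rewrite -[A g](subKr (A f)).
  apply: (asetB hv hL); first exact: value_aset.
  by apply: (asetW hL) h; lia.
rewrite leNgt; apply/negP => lt.
have : aset L (value f + 1) (A f).
  rewrite -[A f](subrK (A g)); apply: (asetD hL) => //.
  by apply: (asetW hL) (value_aset ng); lia.
by move/(value_ge _ nf); lia.
Qed.

End FieldAction.

(** * Almost fields and orthogonal families *)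

Lemma nontrivial_kernel (F : fieldType) k l (M : 'M[F]_(k, l)) : (l < k)%N ->
  exists2 a : 'rV_k, a != 0 & a *m M = 0.
Proof.
move=> lk; have : kermx M != 0.
  rewrite kermx_eq0 /row_free; have := rank_leq_col M; lia.
by move/rowV0Pn => [a /sub_kermxP aM a0]; exists a.
Qed.

Section AlmostField.
Variables (F : fieldType) (v : F -> int) (pi : F).
Hypothesis hv : discrete_valuation v pi.
Variables (m : nat) (e : int) (L : int -> 'cV[F]_m -> Prop).
Hypothesis hL : filtration v e L.
Variable c : 'M[F]_m.
Hypothesis c_field : gen_field L c.
Hypothesis c_norm : normalizes L c.
Local Notation A f := (peval c f).
Local Notation W := (fspan L).
Local Notation nz := (nz L c).
Local Notation value := (value L c).
Implicit Types f g h : {poly F}.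

Variables (rho : nat) (phi : {poly F}).

(* The polynomials of size at most rho act on W as a field up to higher order
   terms: F[X]/(phi), valued through f |-> f(c). *)
Definition almost_field :=
  [/\ (0 < rho)%N, size phi = rho.+1, phi \is monic,
      forall f, f != 0 -> (size f <= rho)%N -> nz f
    & forall f g, f != 0 -> g != 0 -> (size f <= rho)%N -> (size g <= rho)%N ->
      (f * g) %% phi != 0 /\
      aset L (value f + value g + 1) (A (f * g) - A ((f * g) %% phi))].

Hypothesis hAF : almost_field.

Lemma phi_neq0 : phi != 0.
Proof. by have [_ _ /monic_neq0] := hAF. Qed.

Lemma size_modphi f : (size (f %% phi)%R <= rho)%N.
Proof.
by have := ltn_modp f phi; rewrite phi_neq0; case: hAF => _ -> *.
Qed.

Lemma modphi_id f : (size f <= rho)%N -> f %% phi = f.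
Proof. by move=> h; rewrite modp_small //; case: hAF => _ ->. Qed.

Lemma af_mul f g : f != 0 -> g != 0 -> (size f <= rho)%N -> (size g <= rho)%N ->
  nz ((f * g) %% phi) /\ value ((f * g) %% phi) = value f + value g.
Proof.
move=> f0 g0 sf sg; have [r0 sp mp hnz hmul] := hAF.
have nf := hnz _ f0 sf; have ng := hnz _ g0 sg.
have [_ h] := hmul _ _ f0 g0 sf sg.
rewrite -(valueM hv hL c_field c_norm nf ng) in h *.
exact: (value_sub_eq hv hL c_field c_norm (nzM hL c_field c_norm nf ng) h).
Qed.

(** A nontrivial common factor of [g] and [phi] would write [phi] as a product of two small
    polynomials with remainder 0, which an almost field excludes. So [g] is coprime to [phi], and
    Bezout inverts it. *)
Lemma af_div g h : g != 0 -> (size g <= rho)%N -> (size h <= rho)%N ->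
  exists2 f : {poly F}, (size f <= rho)%N & (f * g) %% phi = h.
Proof.
move=> g0 sg sh; have [r0 sp mp hnz hmul] := hAF; have p0 := phi_neq0.
have cop : coprimep g phi.
  rewrite /coprimep; set d := gcdp g phi.
  have d0 : d != 0 by rewrite gcdp_eq0 negb_and g0.
  have dg : d %| g := dvdp_gcdl _ _.
  have /dvdpP[k hk] : d %| phi := dvdp_gcdr _ _.
  have k0 : k != 0 by apply: contraNneq p0 => k0; rewrite hk k0 mul0r.
  have sd : (size d <= rho)%N by apply: leq_trans sg; apply: dvdp_leq.
  apply: contraT => sd1; have sd0 : (0 < size d)%N by rewrite size_poly_gt0.
  have sk : (size k <= rho)%N.
    have := size_mul k0 d0; rewrite -hk sp; move: sd1 sd0.
    by move: (size d) (size k) => a b; case: eqP => // ? _ ?; lia.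
  by have [] := hmul _ _ k0 d0 sk sd; rewrite -hk modpp eqxx.
have [[u w] /= huw] := Bezout_eq1_coprimepP _ _ cop.
exists ((u * h) %% phi); first exact: size_modphi.
rewrite mulrC modp_mul.
have -> : g * (u * h) = h - h * w * phi by rewrite -{2}(mulr1 h) -huw; ring.
by rewrite modpD modpN modp_mull oppr0 addr0 modphi_id.
Qed.

Section Orth.
Implicit Types (k : nat) (n : nat -> 'cV[F]_m).
Local Notation fam := (nat -> {poly F}).

Definition comb k n (f : fam) : 'cV[F]_m :=
  \sum_(t < k) A (f t) *m n t.

Definition small (f : fam) := forall t, (size (f t) <= rho)%N.

(** Orthogonality for norms: a combination never lies deeper than its terms. Polynomials of size at
    most [rho] stand for the elements of F[X]/(phi). *)
Definition orth k n := forall f : fam, small f ->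
  forall s, L s (comb k n f) -> forall t, (t < k)%N -> L s (A (f t) *m n t).

Definition Tspan k n x := exists2 f : fam, small f & x = comb k n f.

Definition nonzero_family k n := forall t, (t < k)%N -> W (n t) /\ n t != 0.

Lemma comb_ext k n n' (f : fam) : (forall t, (t < k)%N -> n t = n' t) ->
  comb k n f = comb k n' f.
Proof. by move=> h; apply: eq_bigr => t _; rewrite h. Qed.

Lemma comb_linear k n a (f g : fam) :
  a *: comb k n f + comb k n g = comb k n (fun t => a *: f t + g t).
Proof.
rewrite scaler_sumr -big_split /=; apply: eq_bigr => t _.
by rewrite pevalD pevalZ mulmxDl scalemxAl.
Qed.

Lemma small_linear a (f g : fam) : small f -> small g -> small (fun t => a *: f t + g t).
Proof.
move=> sf sg t; apply: leq_trans (size_polyD _ _) _; rewrite geq_max sg andbT.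
exact: leq_trans (size_scale_leq _ _) (sf t).
Qed.

Lemma small0 : small (fun=> 0).
Proof. by move=> t; rewrite size_poly0. Qed.

Lemma comb0 k n : comb k n (fun=> 0) = 0.
Proof. by apply: big1 => t _; rewrite peval0 mul0mx. Qed.

Lemma Tspan_subspace k n : subspace (Tspan k n).
Proof.
split; first by exists (fun=> 0); [exact: small0|rewrite comb0].
  move=> x y [f sf ->] [g sg ->]; exists (fun t => 1 *: f t + g t).
    exact: small_linear.
  by rewrite -comb_linear scale1r.
move=> a x [f sf ->]; exists (fun t => a *: f t + (fun=> 0) t).
  by apply: small_linear => //; apply: small0.
by rewrite -comb_linear comb0 addr0.
Qed.

Lemma comb_span k n (f : fam) : nonzero_family k n -> W (comb k n f).
Proof.
move=> h; apply: subspace_sum; first exact: (fspan_subspace hL).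
by move=> t _; apply: (peval_span hL c_norm); case: (h t).
Qed.

Lemma orth_eq0 k n (f : fam) : orth k n -> nonzero_family k n -> small f ->
  comb k n f = 0 -> forall t, (t < k)%N -> f t = 0.
Proof.
move=> ho hn sf h0 t tk; apply: contrapT => /eqP ft0.
have [_ _ _ hnz _] := hAF; have [nW n0] := hn t tk.
suff /eqP : n t = 0 by rewrite (negPf n0).
apply: (nz_inj c_field (hnz _ ft0 (sf t))) => //.
apply: (fil_sep hv hL) => s; apply: ho => //; rewrite h0; exact: (fil0 hL).
Qed.

(** Taking constant polynomials as coefficients, an orthogonal family is linearly independent over
    F. *)
Lemma orth_bound k n : orth k n -> nonzero_family k n -> (k <= m)%N.
Proof.
move=> ho hn; rewrite leqNgt; apply/negP => mk.
have [r0 _ _ _ _] := hAF.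
have [a a0 aM] := nontrivial_kernel (\matrix_(t < k) (n t)^T) mk.
pose f t := (oapp (fun t : 'I_k => a 0 t) 0 (insub t))%:P.
have ff (t : 'I_k) : f t = (a 0 t)%:P by rewrite /f valK.
have sf : small f by move=> t; apply: leq_trans (size_polyC_leq1 _) r0.
case/eqP: a0; apply/rowP => t; rewrite [RHS]mxE; apply: polyC_inj.
rewrite -ff; apply: (orth_eq0 ho hn sf) => //.
apply: trmx_inj; rewrite trmx0 -[RHS]aM mulmx_sum_row linear_sum.
by apply: eq_bigr => i _; rewrite ff pevalC mul_scalar_mx linearZ /= rowK.
Qed.

(** If a combination lay deeper than its last term, multiplying it by the inverse modulo [phi] of
    the last coefficient would give [n k + u], with [u] in the span, of larger order than [n k]. *)
Lemma orth_extend k n : orth k n -> nonzero_family k.+1 n ->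
  (forall u s, Tspan k n u -> L s (n k + u) -> L s (n k)) -> orth k.+1 n.
Proof.
move=> ho hn hbest f sf s; have [r0 sp mp hnz hmul] := hAF.
have [xW x0] := hn k (ltnSn k).
have hn' : nonzero_family k n by move=> t tk; apply: hn; lia.
rewrite /comb big_ord_recr /= -/(comb k n f) => Ls.
suff Lx : L s (A (f k) *m n k).
  move=> t; rewrite ltnS leq_eqVlt => /orP[/eqP -> //|tk].
  by apply: ho => //; rewrite -(addrK (A (f k) *m n k) (comb k n f)); apply: (filB hv hL).
have [->|g0] := eqVneq (f k) 0; first by rewrite peval0 mul0mx; apply: (fil0 hL).
move: (f k) (sf k) g0 Ls => g sg g0 Ls.
have ng := hnz _ g0 sg; set x := n k in xW x0 hbest Ls *.
have yW := peval_span hL c_norm g xW.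
have y0 : A g *m x != 0.
  by apply: contra x0 => /eqP h; apply/eqP; apply: (nz_inj c_field ng) h.
apply/(ordP hv hL) => //; rewrite leNgt; apply/negP => lt.
set s0 := ord L _ in lt; rewrite /s0 (value_ord hv hL c_field c_norm) // in lt.
set o := ord L x in lt; set u := comb k n f in Ls.
have Lx : L o x by apply/(ordP hv hL _ xW x0).
have Lgx : L (o + value g) (A g *m x) by apply: (value_up hL c_field c_norm ng).
have Lu : L (o + value g) u.
  rewrite -(addrK (A g *m x) u); apply: (filB hv hL) => //.
  by apply: (filW hL) Ls; lia.
have [g' sg' gg'] : exists2 g' : {poly F}, (size g' <= rho)%N & (g' * g) %% phi = 1.
  by apply: af_div => //; rewrite size_poly1.
have g'0 : g' != 0.
  by apply: contraTneq isT => h; move: gg'; rewrite h mul0r mod0p => /eqP; rewrite eq_sym oner_eq0.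
have ng' := hnz _ g'0 sg'.
have vg' : value g' = - value g.
  have [_] := af_mul g'0 g0 sg' sg; rewrite gg' -[1]/(1%:P).
  rewrite (valueC hv hL c_field c_norm) ?oner_neq0 //.
  by rewrite (val_1 hv) mulr0; lia.
pose h t := (g' * f t) %% phi.
have sh : small h by move=> t; apply: size_modphi.
(* Replacing a product by its remainder modulo [phi] costs only terms deeper than [o], since
   reduction is exact to leading order in an almost field. *)
have close t : (t < k)%N -> L (o + 1) (A (g' * f t) *m n t - A (h t) *m n t).
  move=> tk; have Lt := ho f sf _ Lu t tk.
  rewrite /h; have [->|ft0] := eqVneq (f t) 0.
    by rewrite mulr0 mod0p subrr; apply: (fil0 hL).
  have nf := hnz _ ft0 (sf t).
  have [_ hc] := hmul _ _ g'0 ft0 sg' (sf t).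
  have Lnt : L (o + value g - value (f t)) (n t).
    by apply: (value_down hL c_field c_norm nf); [case: (hn' t tk)|rewrite subrK].
  have := hc _ _ Lnt; rewrite mulmxBl; apply: (filW hL); rewrite vg'; lia.
have closex : L (o + 1) (A (g' * g) *m x - x).
  have [_ hc] := hmul _ _ g'0 g0 sg' sg.
  have := hc _ _ Lx; rewrite gg' mulmxBl peval1 mul1mx vg'; apply: (filW hL); lia.
have : L (o + 1) (x + comb k n h).
  have -> : x + comb k n h = A g' *m (u + A g *m x) - (A (g' * g) *m x - x)
      - \sum_(t < k) (A (g' * f t) *m n t - A (h t) *m n t).
    rewrite sumrB -/(comb k n h) mulmxDr mulmxA -pevalM.
    have -> : A g' *m u = \sum_(t < k) A (g' * f t) *m n t.
      by rewrite mulmx_sumr; apply: eq_bigr => t _; rewrite pevalM mulmxA.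
    rewrite !opprB; move: (\sum_(t < k) _) (_ *m x) (comb k n h) => a b d.
    by rewrite (addrC x (- b)) (addrA (a + b)) addrK [RHS]addrC addrA subrK addrC.
  apply: (filB hv hL); last by apply: (fil_sum hL) => t _; apply: close.
  apply: (filB hv hL) => //.
  have -> : o + 1 = o + 1 + value g + value g' by rewrite vg'; lia.
  by apply: (value_up hL c_field c_norm ng'); apply: (filW hL) Ls; lia.
move/hbest => h1; have : L (o + 1) x by apply: h1; exists h.
by move/(ordP hv hL _ xW x0); rewrite -/o; lia.
Qed.

Definition extend n k (x : 'cV[F]_m) : nat -> 'cV[F]_m :=
  fun t => if t == k then x else n t.

Lemma orth_extendP k n x : orth k n -> nonzero_family k n -> W x -> x != 0 ->
  (forall u s, Tspan k n u -> L s (x + u) -> L s x) ->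
  orth k.+1 (extend n k x) /\ nonzero_family k.+1 (extend n k x).
Proof.
move=> ho hn xW x0 hbest.
have ext t : (t < k)%N -> extend n k x t = n t by rewrite /extend; case: eqP => // ->; rewrite ltnn.
have extk : extend n k x k = x by rewrite /extend eqxx.
have hn' : nonzero_family k.+1 (extend n k x).
  move=> t; rewrite ltnS leq_eqVlt => /orP[/eqP ->|tk]; first by rewrite extk.
  by rewrite ext //; apply: hn.
split=> //; apply: orth_extend => //; rewrite ?extk.
  move=> f sf s; rewrite (comb_ext _ ext) => h t tk; rewrite ext //; exact: ho h t tk.
move=> u s [f sf ->]; rewrite (comb_ext _ ext); apply: hbest; by exists f.
Qed.

(** An orthogonal family of maximal length spans: a missed vector, corrected by its best
    approximation, would extend it. *)
Lemma orth_basis : exists k n, [/\ orth k n, nonzero_family k n &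
  forall x, W x -> Tspan k n x].
Proof.
pose Q k := exists n, orth k n /\ nonzero_family k n.
have Q0 : exists k, Q k by exists 0%N, (fun=> 0); split.
have Qm k : Q k -> (k <= m)%N by move=> [n [h1 h2]]; apply: orth_bound h2.
have [k [[n [ho hn]] kmax]] := nat_has_max Q0 Qm; exists k, n; split=> // x xW.
apply: contrapT => nx; have hS := Tspan_subspace k n.
have SW u : Tspan k n u -> W u by move=> [f _ ->]; apply: comb_span.
have [u [Su ubest]] := best_approx hv hL hS SW xW nx.
have [_ WD _] := fspan_subspace hL; have [_ SD _] := hS.
suff /kmax : Q k.+1 by rewrite ltnn.
exists (extend n k (x + u)); apply: orth_extendP => //; first by apply: WD => //; apply: SW.
  apply/eqP => h; apply: nx; have -> : x = 0 - u by rewrite -h addrK.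
  by apply: subspaceB => //; case: hS.
by move=> u' s Su'; rewrite -addrA; apply: ubest; apply: SD.
Qed.

End Orth.
End AlmostField.

(** * Graded commutation *)

Section GradedCommutation.
Variables (F : fieldType) (v : F -> int) (pi : F).
Hypothesis hv : discrete_valuation v pi.
Variables (m : nat) (e : int) (L : int -> 'cV[F]_m -> Prop).
Hypothesis hL : filtration v e L.
Variable c : 'M[F]_m.
Hypothesis c_field : gen_field L c.
Hypothesis c_norm : normalizes L c.
Local Notation A f := (peval c f).
Local Notation W := (fspan L).
Local Notation nz := (nz L c).
Local Notation value := (value L c).
Implicit Types f g h : {poly F}.

Variable x : 'M[F]_m.
Hypothesis hx : aset L 0 x.

Definition comm f := x *m A f - A f *m x.

(* x commutes with f(c) in the graded algebra of the filtration *)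
Definition good f := aset L (value f + 1) (comm f).

Lemma commM f g : comm (f * g) = comm f *m A g + A f *m comm g.
Proof.
rewrite /comm pevalM mulmxBl mulmxBr !mulmxA addrA subrK.
by rewrite -!mulmxA.
Qed.

Lemma commB f g : comm (f - g) = comm f - comm g.
Proof.
rewrite /comm pevalB mulmxBl mulmxBr !opprB addrACA [RHS]addrACA.
by rewrite (addrC (- (x *m _))).
Qed.

Lemma commZ a f : comm (a *: f) = a *: comm f.
Proof. by rewrite /comm pevalZ scalerBr -scalemxAl -scalemxAr. Qed.

Lemma commC a : comm a%:P = 0.
Proof. by rewrite /comm pevalC scalar_mxC subrr. Qed.

Lemma aset_span k (a : 'M[F]_m) y : aset L k a -> W y -> W (a *m y).
Proof. by move=> ha [s hs]; exists (s + k); apply: ha. Qed.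

Lemma comm_span f y : W y -> W (comm f *m y).
Proof.
move=> yW; rewrite mulmxBl -!mulmxA; apply: subspaceB; first exact: (fspan_subspace hL).
  by apply: (aset_span hx); apply: (peval_span hL c_norm).
by apply: (peval_span hL c_norm); apply: (aset_span hx).
Qed.

Lemma goodZ a f : a != 0 -> nz f -> good f -> good (a *: f).
Proof.
move=> a0 nf; rewrite /good commZ (valueZ hv hL c_field c_norm) // => h.
by have := asetZ hL a0 h; rewrite addrAC [value f + _]addrC.
Qed.

Lemma goodM f g : nz f -> nz g -> good f -> good g -> good (f * g).
Proof.
move=> nf ng gf gg; rewrite /good (valueM hv hL c_field c_norm) // commM.
apply: (asetD hL).
  by rewrite addrAC; apply: asetM => //; apply: (value_aset hL c_field c_norm).
by rewrite -addrA; apply: asetM => //; apply: (value_aset hL c_field c_norm).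
Qed.

(** By the product rule f(c) times the commutator of [g] is deep, and f(c), being a similitude on
    the span, can be cancelled. *)
Lemma good_cancel f g : nz f -> nz g -> good f ->
  aset L (value f + value g + 1) (comm (f * g)) -> good g.
Proof.
move=> nf ng gf h.
have : aset L (value f + value g + 1) (A f *m comm g).
  have -> : A f *m comm g = comm (f * g) - comm f *m A g by rewrite commM addrC addKr.
  apply: (asetB hv hL) => //.
  by rewrite addrAC; apply: asetM => //; apply: (value_aset hL c_field c_norm).
move=> {}h s y hy; have yW : W y by exists s.
apply: (value_down hL c_field c_norm nf); first exact: comm_span.
by rewrite mulmxA; have := h _ _ hy; apply: (filW hL); lia.
Qed.

Lemma agree_value f g : nz f -> agree_on L (A f) (A g) -> nz g /\ value g = value f.
Proof.
move=> nf h; apply: (value_sub_eq hv hL c_field c_norm nf) => s y /h hy.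
by rewrite mulmxBl hy subrr; apply: (fil0 hL).
Qed.

Lemma agree_good f g : nz f -> agree_on L (A f) (A g) -> good g -> good f.
Proof.
move=> nf h; have [ng vg] := agree_value nf h.
rewrite /good vg => hg s y hy; have -> : comm f *m y = comm g *m y; last exact: hg.
have [t ht] : W (x *m y) by apply: (aset_span hx); exists s.
by rewrite !mulmxBl -!mulmxA (h _ _ hy) (h _ _ ht).
Qed.

Lemma minimal_bad f0 : nz f0 -> ~ good f0 -> exists rho phi,
  [/\ almost_field L c rho phi, nz phi, ~ good phi &
      forall f, f != 0 -> (size f <= rho)%N -> good f].
Proof.
move=> nf0 bf0.
have hP : exists k, `[< exists f, [/\ nz f, ~ good f & size f = k] >].
  by exists (size f0); apply/asboolP; exists f0.
case: (ex_minnP hP) => k /asboolP [p [np bp sp]] kmin.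
have {}kmin f : nz f -> (size f < k)%N -> good f.
  move=> nf; rewrite ltnNge => /negP h; apply: contrapT => bf; apply: h.
  by apply: kmin; apply/asboolP; exists f.
have p0 : p != 0.
  by apply/eqP => p0; apply: np; rewrite p0 => s y _; rewrite peval0.
have lp0 : (lead_coef p)^-1 != 0 by rewrite invr_eq0 lead_coef_eq0.
pose phi := (lead_coef p)^-1 *: p.
have nphi : nz phi by apply: (nzZ hL c_field c_norm).
have bphi : ~ good phi.
  move=> h; apply: bp; have <- : lead_coef p *: phi = p.
    by rewrite scalerA divff ?lead_coef_eq0 // scale1r.
  by apply: goodZ; rewrite ?lead_coef_eq0.
have mphi : phi \is monic by rewrite monicE lead_coefZ mulVf // lead_coef_eq0.
have sphi : size phi = k by rewrite size_scale.
have phi0 := monic_neq0 mphi.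
have k1 : (1 < k)%N.
  rewrite ltnNge -sphi; apply/negP => /size1_polyC h; apply: bphi.
  rewrite /good {2}h commC => s y _; rewrite mul0mx; exact: (fil0 hL).
exists k.-1, phi.
(* If f(c) vanished, [phi] would agree on the span with its remainder modulo [f], which has smaller
   degree and hence is good. *)
have nzs f : f != 0 -> (size f <= k.-1)%N -> nz f.
  move=> fn0 sf h.
  have ag : agree_on L (A phi) (A (phi %% f)).
    move=> s y hy; rewrite {1}(divp_eq phi f) pevalD pevalM mulmxDl -mulmxA.
    by rewrite (h _ _ hy) mul0mx mulmx0 add0r.
  apply: bphi; apply: (agree_good nphi ag); apply: kmin.
    exact: (agree_value nphi ag).1.
  by apply: (@leq_trans (size f)); [rewrite ltn_modp|lia].
have gds f : f != 0 -> (size f <= k.-1)%N -> good f.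
  by move=> fn0 sf; apply: kmin; [apply: nzs|lia].
split=> //; split=> //; first by lia.
  by rewrite sphi; lia.
move=> f g fn0 gn0 sf sg.
have nf := nzs _ fn0 sf; have ng := nzs _ gn0 sg.
have nfg := nzM hL c_field c_norm nf ng.
rewrite -(valueM hv hL c_field c_norm) //.
set a := (f * g) %/ phi; set h := (f * g) %% phi.
have fgE : f * g = a * phi + h := divp_eq _ _.
have main : aset L (value (f * g) + 1) (A (f * g) - A h).
  rewrite -pevalB fgE addrK.
  have [->|a0] := eqVneq a 0.
    by rewrite mul0r peval0; apply: (aset0 hL).
  have sa : (size a <= k.-1)%N.
    rewrite size_divp // sphi.
    rewrite size_mul //.
    have : (0 < size f)%N by rewrite size_poly_gt0.
    by move: sf sg; move: (size f) (size g) => i j; lia.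
  have na := nzs _ a0 sa.
  have nap := nzM hL c_field c_norm na nphi.
  apply/(value_ge hv hL c_field c_norm) => //; rewrite -fgE.
  (* If [a * phi] had value at most that of [f * g], so would its comparison with the remainder [h]:
     the value of [h] is at least that of [a * phi]. The commutators of [f * g] and [h] then both
     lie strictly beyond that value, so does their difference, and cancelling the good factor [a]
     would make [phi] good. *)
  have [le|//] := lerP (value (a * phi)) (value (f * g)); last by lia.
  case: bphi; apply: (good_cancel na nphi (gds _ a0 sa)).
  rewrite -(valueM hv hL c_field c_norm) //.
  have gfg := goodM nf ng (gds _ fn0 sf) (gds _ gn0 sg).
  have apE : a * phi = f * g - h by rewrite fgE addrK.
  rewrite {2}apE commB; apply: (asetB hv hL).
    by apply: (asetW hL) gfg; rewrite lerD2r.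
  have Ah : aset L (value (a * phi)) (A h).
    have -> : h = f * g - a * phi by rewrite fgE addrC addKr.
    rewrite pevalB; apply: (asetB hv hL); last exact: (value_aset hL c_field c_norm).
    exact: (asetW hL) le (value_aset hL c_field c_norm nfg).
  have [->|h0] := eqVneq h 0; first by rewrite -[0]/(0%:P) commC; apply: (aset0 hL).
  have sh : (size h <= k.-1)%N.
    rewrite -ltnS prednK; last by lia.
    by rewrite -[k in X in (_ < X)%N]sphi ltn_modp.
  have nh := nzs _ h0 sh; have := gds _ h0 sh; apply: (asetW hL).
  by rewrite lerD2r; apply: (value_ge hv hL c_field c_norm _ nh).1 Ah.
split=> //.
have [nh _] := value_sub_eq hv hL c_field c_norm nfg main.
by apply/eqP => h0; apply: nh; rewrite h0 => s y _; rewrite peval0.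
Qed.
End GradedCommutation.

(** * Optimal polynomials and the dual basis *)

Lemma coefM_top (R : comNzRingType) (p q : {poly R}) a b :
  (size p <= a.+1)%N -> (size q <= b.+1)%N -> (p * q)`_(a + b) = p`_a * q`_b.
Proof.
move=> sp sq; have ha : (a < (a + b).+1)%N by lia.
rewrite coefM (bigD1 (Ordinal ha)) //= addKn big1 ?addr0 // => i ia.
have {}ia : (i : nat) != a by apply: contraNneq ia => ia; apply/eqP/val_inj.
have [lt|ge] := ltnP i a.
  by rewrite [q`__]nth_default ?mulr0 //; apply: leq_trans sq _; lia.
by rewrite nth_default ?mul0r //; apply: leq_trans sp _; lia.
Qed.

Section MonicQuotients.
Variables (F : fieldType) (rho : nat) (phi : {poly F}).
Hypotheses (rho0 : (0 < rho)%N) (sphi : size phi = rho.+1) (mphi : phi \is monic).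
Implicit Types f : {poly F}.

(** A linear form on F[X]/(phi) with perfect associated pairing; for separable [phi] it is f |->
    Tr(f / phi'). *)
Definition topc f := (f %% phi)`_rho.-1.

Lemma topc_linear a f g : topc (a *: f + g) = a * topc f + topc g.
Proof. by rewrite /topc modpD modpZl coefD coefZ. Qed.

Lemma topc_sum k (a : nat -> F) (h : nat -> {poly F}) :
  topc (\sum_(j < k) a j *: h j) = \sum_(j < k) a j * topc (h j).
Proof.
elim: k => [|k IH]; first by rewrite !big_ord0 /topc mod0p coef0.
by rewrite !big_ord_recr /= addrC topc_linear IH addrC.
Qed.

(* Euler: the successive quotients of phi form the basis dual to 1, X, X^2...
   for the form topc *)
Lemma topc_dual f j : (size f <= rho)%N -> (j < rho)%N ->
  topc (f * drop_poly j.+1 phi) = f`_j.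
Proof.
(* The part of [f] above degree [j] contributes, modulo [phi], minus its quotient times the low part
   of [phi], of degree below [rho.-1]. The low part reaches the top coefficient only through the
   coefficient of X^j times the leading 1 of [phi]. *)
move=> sf jr; rewrite -{1}(poly_take_drop j.+1 f) mulrDl -mulrA.
have -> : 'X^(j.+1) * drop_poly j.+1 phi = phi - take_poly j.+1 phi.
  by rewrite -{2}(poly_take_drop j.+1 phi) [RHS]addrC addKr mulrC.
rewrite mulrBr /topc !modpD modpN modp_mull add0r coefD.
have st : (size (take_poly j.+1 f) <= j.+1)%N := size_take_poly _ _.
have sd : (size (drop_poly j.+1 phi) <= (rho - j.+1).+1)%N.
  by rewrite size_drop_poly sphi; lia.
rewrite modp_small; last first.
  rewrite sphi ltnS; apply: leq_trans (size_polyMleq _ _) _.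
  by move: st sd; move: (size (take_poly _ _)) (size (drop_poly _ _)) => a b; lia.
rewrite coefN modp_small; last first.
  rewrite sphi ltnS; apply: leq_trans (size_polyMleq _ _) _.
  have := size_take_poly j.+1 phi; rewrite size_drop_poly.
  by move: sf; move: (size (take_poly _ _)) (size f) => i i'; lia.
rewrite [X in _ - X]nth_default; last first.
  apply: leq_trans (size_polyMleq _ _) _.
  have := size_take_poly j.+1 phi; rewrite size_drop_poly.
  by move: sf; move: (size (take_poly _ _)) (size f) => i i'; lia.
have -> : rho.-1 = (j + (rho - j.+1))%N by lia.
rewrite subr0 -[RHS]mulr1 coefM_top // coef_take_poly ltnSn coef_drop_poly.
congr (_ * _); rewrite subnK //; move/monicP: mphi.
by rewrite lead_coefE sphi.
Qed.

Lemma modphi_X f : (size f <= rho)%N -> ('X * f) %% phi = 'X * f - f`_rho.-1 *: phi.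
Proof.
move=> sf; have E : 'X * f = (f`_rho.-1)%:P * phi + ('X * f - f`_rho.-1 *: phi).
  by rewrite mul_polyC addrC subrK.
rewrite {1}E modp_addl_mul_small //.
  rewrite sphi ltnS; apply/leq_sizeP => i ir; rewrite coefB coefZ coefXM.
  have [ei|ne] := eqVneq i rho.
    rewrite ei gtn_eqF // -[phi`_rho]/(phi`_(rho.+1.-1)) -sphi -lead_coefE.
    by rewrite (monicP mphi) mulr1 subrr.
  rewrite gtn_eqF; last by lia.
  rewrite [phi`_i]nth_default ?sphi; last by lia.
  by rewrite mulr0 subr0 nth_default //; apply: leq_trans sf _; lia.
Qed.
End MonicQuotients.

Section Approximation.
Variables (F : fieldType) (v : F -> int) (pi : F).
Hypothesis hv : discrete_valuation v pi.
Variables (m : nat) (e : int) (L : int -> 'cV[F]_m -> Prop).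
Hypothesis hL : filtration v e L.
Variable c : 'M[F]_m.
Hypothesis c_field : gen_field L c.
Hypothesis c_norm : normalizes L c.
Local Notation A f := (peval c f).
Local Notation W := (fspan L).
Local Notation nz := (nz L c).
Local Notation value := (value L c).
Implicit Types f g h : {poly F}.

Variables (rho : nat) (phi : {poly F}).
Hypothesis hAF : almost_field L c rho phi.

(** For monic [f] of degree [l] the vectors f(c) x fill a coset of the space of lower-degree
    multiples of x. The coset misses 0, so it stays out of deep lattices. *)
Lemma value_monic_bounded l : (l < rho)%N -> exists s, forall f,
  f \is monic -> size f = l.+1 -> value f <= s.
Proof.
move=> lr; have [r0 sp mp hnz hmul] := hAF.
have [x [xW x0]] := exists_nonzero c_field.
pose S y := exists2 g : {poly F}, (size g <= l)%N & y = A g *m x.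
have hS : subspace S.
  split; first by exists 0; rewrite ?size_poly0 // peval0 mul0mx.
    move=> y z [f sf ->] [g sg ->]; exists (f + g); last by rewrite pevalD mulmxDl.
    by apply: leq_trans (size_polyD _ _) _; rewrite geq_max sf.
  move=> a y [f sf ->]; exists (a *: f); last by rewrite pevalZ scalemxAl.
  exact: leq_trans (size_scale_leq _ _) sf.
have nS : ~ S (A 'X^l *m x).
  move=> [g sg hg].
  have s1 : size ('X^l - g) = l.+1.
    by rewrite size_polyDl ?size_polyXn // size_polyN ltnS.
  have n0 : 'X^l - g != 0 by rewrite -size_poly_gt0 s1.
  suff /eqP : x = 0 by rewrite (negPf x0).
  apply: (nz_inj c_field (hnz _ n0 _) xW); first by rewrite s1.
  by rewrite pevalB mulmxBl hg subrr.
have [s hs] := fil_bounded hv hL hS nS.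
exists (s - ord L x) => f mf sf.
have nf : nz f by apply: hnz; rewrite ?monic_neq0 // sf.
have Lx : L (ord L x) x by apply/(ordP hv hL _ xW x0).
rewrite leNgt; apply/negP => lt.
apply: (hs (A (f - 'X^l) *m x)).
  exists (f - 'X^l) => //; apply/leq_sizeP => i li; rewrite coefB coefXn.
  have [->|ne] := eqVneq i l; last by rewrite subr0 nth_default // sf; lia.
  by have := monicP mf; rewrite lead_coefE sf => ->; rewrite subrr.
rewrite pevalB mulmxBl addrC subrK.
by apply: (filW hL) (value_up hL c_field c_norm nf Lx); lia.
Qed.

(** Monic polynomials of greatest value in each degree, like Okutsu's divisor polynomials; they
    serve as an orthogonal F-basis of F[X]/(phi). *)
Definition optimal (M : nat -> {poly F}) := forall l, (l < rho)%N ->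
  [/\ M l \is monic, size (M l) = l.+1 &
      forall f, f \is monic -> size f = l.+1 -> value f <= value (M l)].

Lemma optimal_ex : exists M, optimal M.
Proof.
suff /choice[M hM] : forall l, exists p : {poly F}, (l < rho)%N ->
  [/\ p \is monic, size p = l.+1 &
      forall f, f \is monic -> size f = l.+1 -> value f <= value p].
  by exists M.
move=> l; have [lr|] := boolP (l < rho)%N; last by exists 0.
have [s hs] := value_monic_bounded lr.
pose T k := exists p : {poly F}, [/\ p \is monic, size p = l.+1 & value p = k].
have [|k [p [mp sp <-]]|k [[p [mp sp pk]] kmax]] := @int_has_max T s.
- by exists (value 'X^l), 'X^l; rewrite monicXn size_polyXn.
- exact: hs.
exists p => _; split=> // f mf sf; rewrite pk; apply: kmax; by exists f.
Qed.

Section Basis.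
Variable M : nat -> {poly F}.
Hypothesis hM : optimal M.

Lemma optimal_nz l : (l < rho)%N -> nz (M l).
Proof.
by move=> lr; have [mM sM _] := hM lr; case: hAF => _ _ _ h _; apply: h; rewrite ?monic_neq0 ?sM.
Qed.

Lemma optimal_size k (a : nat -> F) : (k <= rho)%N ->
  (size (\sum_(l < k) a l *: M l)%R <= k)%N.
Proof.
elim: k => [|k IH] kr; first by rewrite big_ord0 size_poly0.
rewrite big_ord_recr /=; apply: leq_trans (size_polyD _ _) _; rewrite geq_max.
have := IH (ltnW kr) => /leq_trans -> //=.
by apply: leq_trans (size_scale_leq _ _) _; have [_ -> _] := hM kr.
Qed.

Lemma optimal_expand k f : (k <= rho)%N -> (size f <= k)%N ->
  exists a : nat -> F, f = \sum_(l < k) a l *: M l.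
Proof.
elim: k f => [|k IH] f kr sf.
  exists (fun=> 0); rewrite big_ord0; apply/eqP; by rewrite -size_poly_leq0.
have [mM sM _] := hM kr.
have [||a ha] := IH (f - f`_k *: M k); first exact: ltnW.
  apply/leq_sizeP => i ki; rewrite coefB coefZ.
  have [->|ne] := eqVneq i k.
    by have := monicP mM; rewrite lead_coefE sM => ->; rewrite mulr1 subrr.
  rewrite [(M k)`_i]nth_default ?sM; last by lia.
  by rewrite mulr0 subr0 nth_default //; apply: leq_trans sf _; lia.
exists (fun l => if l == k then f`_k else a l).
rewrite big_ord_recr /= eqxx -[LHS](subrK (f`_k *: M k)) ha; congr (_ + _).
by apply: eq_bigr => l _; rewrite ltn_eqF.
Qed.

(** Divided by its leading coefficient [f] is monic, so optimality bounds its value by that of the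
    leading term. Removing this term does not lower the value, and induction reaches the others. *)
Lemma optimal_orth k (a : nat -> F) f l : (k <= rho)%N -> f = \sum_(l < k) a l *: M l ->
  (l < k)%N -> a l != 0 -> f != 0 /\ value f <= e * v (a l) + value (M l).
Proof.
elim: k f l => [//|k IH] f l kr; rewrite big_ord_recr /=.
set f' := \sum_(_ < _) _ => fE lk al.
have [mM sM hopt] := hM kr; have nM := optimal_nz kr.
have [ak0|ak] := eqVneq (a k) 0.
  rewrite ak0 scale0r addr0 in fE; rewrite fE; apply: IH => //; first exact: ltnW.
  by move: lk; rewrite ltnS leq_eqVlt => /orP[/eqP lk|//]; rewrite lk ak0 eqxx in al.
have sf' : (size f' <= k)%N by apply: optimal_size; apply: ltnW.
have sfm : size ((a k)^-1 *: f) = k.+1.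
  rewrite fE scalerDr scalerA mulVf // scale1r addrC size_polyDl // sM ltnS.
  exact: leq_trans (size_scale_leq _ _) sf'.
have mfm : (a k)^-1 *: f \is monic.
  rewrite monicE lead_coefE sfm /= coefZ fE coefD coefZ nth_default // add0r.
  by have := monicP mM; rewrite lead_coefE sM => ->; rewrite mulr1 mulVf.
have fm0 := monic_neq0 mfm.
have f0 : f != 0 by apply: contra fm0 => /eqP ->; rewrite scaler0.
have [_ _ _ hnz _] := hAF.
have nfm : nz ((a k)^-1 *: f) by apply: hnz; rewrite ?sfm.
have nf : nz f by apply: hnz => //; rewrite -(@size_scale _ (a k)^-1) ?invr_eq0 // sfm.
have vk : value f <= e * v (a k) + value (M k).
  have -> : f = a k *: ((a k)^-1 *: f) by rewrite scalerA divff // scale1r.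
  by rewrite (valueZ hv hL c_field c_norm) // lerD2l; apply: hopt.
split=> //; move: lk; rewrite ltnS leq_eqVlt => /orP[/eqP -> //|lk].
have [f'0 vf'] := IH f' l (ltnW kr) erefl lk al.
apply: le_trans vf'; have nf' : nz f' by apply: hnz => //; apply: leq_trans sf' (ltnW kr).
apply/(value_ge hv hL c_field c_norm) => //.
have -> : f' = f - a k *: M k by rewrite fE addrK.
rewrite pevalB; apply: (asetB hv hL); first exact: (value_aset hL c_field c_norm).
apply/(value_ge hv hL c_field c_norm); first exact: (nzZ hL c_field c_norm).
by rewrite (valueZ hv hL c_field c_norm).
Qed.

Variable x : 'M[F]_m.
Local Notation comm := (comm c x).

(** The product rule along Horner's scheme. The left factors are the successive quotients of [f];
    for [f = phi] these are the dual basis of the powers of X. *)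
Lemma comm_expand k f : (size f <= k.+1)%N ->
  comm f = \sum_(j < k) A (drop_poly j.+1 f) *m comm 'X *m A 'X^j.
Proof.
elim: k f => [|k IH] f sf.
  by rewrite big_ord0 (size1_polyC sf) commC.
have -> : comm f = comm (drop_poly 1 f * 'X).
  rewrite -{1}(poly_take_drop 1 f) expr1 addrC -[take_poly 1 f]opprK commB.
  have -> : take_poly 1 f = (f`_0)%:P.
    by apply/polyP => i; rewrite coef_take_poly coefC; case: i.
  by rewrite -polyCN commC subr0.
rewrite commM IH; last by rewrite size_drop_poly; lia.
rewrite big_ord_recl /= expr0 peval1 mulmx1 addrC; congr (_ + _).
rewrite mulmx_suml; apply: eq_bigr => j _.
rewrite -mulmxA -pevalM -exprSr; congr (_ *m _ *m _); congr (peval c _).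
by apply/polyP => i; rewrite !coef_drop_poly -addnA addn1.
Qed.

Lemma comm_bound r : aset L (- r) (comm 'X) ->
  aset L (value (M rho.-1) - r) (comm phi).
Proof.
move=> hr; have [r0 sp mp hnz hmul] := hAF; set mu := value _.
have r1 : (rho.-1 < rho)%N by lia.
pose h j := drop_poly j.+1 phi.
have sh j : (size (h j) <= rho)%N by rewrite size_drop_poly sp; lia.
have [C hC] : exists C : nat -> nat -> F, forall j, (j < rho)%N ->
    'X^j = \sum_(l < rho) C j l *: M l.
  suff /choice[C hC] : forall j, exists a : nat -> F, (j < rho)%N ->
    'X^j = \sum_(l < rho) a l *: M l by exists C.
  move=> j; have [jr|] := boolP (j < rho)%N; last by exists (fun=> 0).
  by have [||a ha] := @optimal_expand rho 'X^j; rewrite ?size_polyXn //; exists a.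
(* The family dual to [M]: the sum of the tensors of [h j] with X^j is rewritten in the basis [M],
   with [g l] collecting the left factors of [M l]. *)
pose g l := \sum_(j < rho) C j l *: h j.
have sg l : (size (g l) <= rho)%N.
  apply: leq_trans (size_sum _ _ _) _; apply/bigmax_leqP => j _.
  exact: leq_trans (size_scale_leq _ _) (sh j).
rewrite (@comm_expand rho); last by rewrite sp.
have -> : \sum_(j < rho) A (drop_poly j.+1 phi) *m comm 'X *m A 'X^j =
    \sum_(l < rho) A (g l) *m comm 'X *m A (M l).
  transitivity (\sum_(j < rho) \sum_(l < rho) C j l *: (A (h j) *m comm 'X *m A (M l))).
    apply: eq_bigr => j _; rewrite {1}(hC j) // peval_sum mulmx_sumr.
    by apply: eq_bigr => l _; rewrite pevalZ -scalemxAr.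
  rewrite exchange_big /=; apply: eq_bigr => l _.
  rewrite /g peval_sum !mulmx_suml; apply: eq_bigr => j _.
  by rewrite pevalZ -!scalemxAl.
apply: (aset_sum hL) => l _.
have [->|gl0] := eqVneq (g l) 0.
  by rewrite peval0 !mul0mx; apply: (aset0 hL).
have lr := ltn_ord l.
have ngl := hnz _ gl0 (sg l); have nMl := optimal_nz lr.
(* Choose [f] with f g_l = M_{rho-1} modulo [phi], so that value f + value g_l = mu. By duality the
   coefficient of M_l in [f] is the top coefficient of M_{rho-1}, which is 1; orthogonality then
   gives value f <= value M_l. *)
suff le : mu <= value (g l) + value (M l).
  apply: (@asetW _ _ _ _ _ hL (value (g l) - r + value (M l))); first by lia.
  apply: asetM; last exact: (value_aset hL c_field c_norm).
  by apply: asetM => //; apply: (value_aset hL c_field c_norm).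
have [mM sM _] := hM r1.
have [f sf fg] : exists2 f : {poly F}, (size f <= rho)%N & (f * g l) %% phi = M rho.-1.
  by apply: (af_div hAF) => //; rewrite sM; lia.
have f0 : f != 0.
  apply: contraTneq (monic_neq0 mM) => f0; move: fg; rewrite f0 mul0r mod0p => <-.
  by rewrite eqxx.
have [_] := af_mul hv hL c_field c_norm hAF f0 gl0 sf (sg l).
rewrite fg -/mu => ->; rewrite addrC lerD2l.
pose a l := \sum_(j < rho) f`_j * C j l.
have fE : f = \sum_(l < rho) a l *: M l.
  rewrite -{1}[f]coefK poly_def (big_ord_widen_cond _ xpredT (fun i => f`_i *: 'X^i) sf).
  rewrite big_mkcond /=.
  transitivity (\sum_(j < rho) \sum_(l < rho) (f`_j * C j l) *: M l).
    apply: eq_bigr => j _; case: ltnP => [_|ge].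
      by rewrite {1}(hC j) // scaler_sumr; apply: eq_bigr => i _; rewrite scalerA.
    by rewrite big1 // => i _; rewrite nth_default // mul0r scale0r.
  rewrite exchange_big /=; apply: eq_bigr => i _; by rewrite scaler_suml.
have al1 : a l = 1.
  have -> : a l = topc rho phi (f * g l).
    rewrite /g mulr_sumr.
    transitivity (topc rho phi (\sum_(j < rho) C j l *: (f * h j))).
      rewrite (@topc_sum F rho phi rho (fun j => C j l) (fun j => f * h j)); apply: eq_bigr => j _.
      by rewrite (topc_dual r0 sp mp) // mulrC.
    by congr (topc _ _ _); apply: eq_bigr => j _; rewrite scalerAr.
  by rewrite /topc fg; have := monicP mM; rewrite lead_coefE sM.
have [|_] := optimal_orth (leqnn _) fE lr; first by rewrite al1 oner_neq0.
by rewrite al1 (val_1 hv) mulr0 add0r.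
Qed.
End Basis.
End Approximation.

(** * Lowering the degree *)

Section Refinement.
Variables (F : fieldType) (v : F -> int) (pi : F).
Hypothesis hv : discrete_valuation v pi.
Variables (m : nat) (e : int) (L : int -> 'cV[F]_m -> Prop).
Hypothesis hL : filtration v e L.
Variable c : 'M[F]_m.
Hypothesis c_field : gen_field L c.
Hypothesis c_norm : normalizes L c.
Local Notation A f := (peval c f).
Local Notation W := (fspan L).
Local Notation nz := (nz L c).
Local Notation value := (value L c).

Variables (rho : nat) (phi : {poly F}).
Hypothesis hAF : almost_field L c rho phi.
Variables (r mu : int).
Hypothesis hmu : forall f : {poly F}, f \is monic -> size f = rho -> value f <= mu.
Hypothesis nphi : nz phi.
Hypothesis hphi : mu - r <= value phi.

(* G is multiplication by X on a sum of copies of F[X]/(phi) spanned by an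
   orthogonal family; it differs from c by multiples of phi(c), which lie deep *)
Lemma degree_reduction : exists G : 'M[F]_m,
  [/\ aset L (- r) (G - c), gen_field L G, normalizes L G & ext_degree L G rho].
Proof.
have [r0 sp mp hnz hmul] := hAF; have p0 := phi_neq0 hAF.
have [k [n [ho hn hspan]]] := orth_basis hv hL c_field c_norm hAF.
have combW (f : nat -> {poly F}) : W (comb c k n f) by apply: (comb_span hL c_norm).
have [cf hcf] : exists cf : 'cV[F]_m -> nat -> {poly F}, forall x, W x ->
    small rho (cf x) /\ x = comb c k n (cf x).
  suff /choice[cf hcf] : forall x, exists f : nat -> {poly F}, W x ->
    small rho f /\ x = comb c k n f by exists cf.
  move=> x; have [xW|nx] := pselect (W x); last by exists (fun=> 0).
  by have [f sf ex] := hspan x xW; exists f.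
(* Orthogonality makes coordinates unique, so the chosen coordinates are linear and [G] is well
   defined. *)
have cfU f t : small rho f -> (t < k)%N -> cf (comb c k n f) t = f t.
  move=> sf tk; have [s1 e1] := hcf _ (combW f).
  apply/eqP; rewrite -subr_eq0; apply/eqP.
  pose d t := (-1) *: f t + cf (comb c k n f) t.
  have sd : small rho d by apply: small_linear.
  have := orth_eq0 hv hL c_field hAF ho hn sd.
  rewrite -comb_linear -e1 scaleN1r addNr => /(_ erefl t tk).
  by rewrite /d scaleN1r addrC.
pose act (p : {poly F}) (f : nat -> {poly F}) t := (p * f t) %% phi.
have sact p f : small rho (act p f) by move=> t; apply: (size_modphi hAF).
have actE (f f' : nat -> {poly F}) : (forall t, (t < k)%N -> f t = f' t) ->
    comb c k n f = comb c k n f'.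
  by move=> h; apply: eq_bigr => t _; rewrite h.
have [G hG] : exists G : 'M[F]_m, forall x, W x -> G *m x = comb c k n (act 'X (cf x)).
  apply: (subspace_linear_mx (fspan_subspace hL)) => a x y xW yW.
  have [sx ex] := hcf x xW; have [sy ey] := hcf y yW.
  rewrite comb_linear; apply: actE => t tk.
  rewrite {1}ex {1}ey comb_linear /act cfU //; last exact: small_linear.
  by rewrite mulrDr -scalerAr modpD modpZl.
have GE f : small rho f -> G *m comb c k n f = comb c k n (act 'X f).
  by move=> sf; rewrite hG //; apply: actE => t tk; rewrite /act cfU.
have GpE p f : small rho f -> peval G p *m comb c k n f = comb c k n (act p f).
  elim/poly_ind: p f => [|p a IH] f sf.
    by rewrite peval0 mul0mx -(comb0 c k n); apply: actE => t _; rewrite /act mul0r mod0p.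
  rewrite pevalD pevalM pevalX pevalC mulmxDl -mulmxA GE // IH // mul_scalar_mx.
  rewrite addrC comb_linear; apply: actE => t tk.
  rewrite /act modp_mul mulrDl mulrA modpD addrC mul_polyC modpZl.
  by rewrite (modphi_id hAF (sf t)).
have Gmod (p : {poly F}) : agree_on L (peval G p) (peval G (p %% phi)).
  move=> s x hx; have [sx ->] := hcf x (ex_intro _ s hx).
  rewrite !GpE //; apply: actE => t tk; rewrite /act.
  by rewrite [p %% phi * _]mulrC modp_mul mulrC.
(* Reduction modulo [phi] preserves values, so p(G) shifts every term of an orthogonal expansion as
   far as p(c) would. Applied also to the inverse, this shows that F[G] normalises [L]. *)
have Gsim (p : {poly F}) : p != 0 -> (size p <= rho)%N -> aset L (value p) (peval G p).
  move=> pn0 psz s x hx; have [sx ex] := hcf x (ex_intro _ s hx).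
  rewrite ex GpE //; rewrite ex in hx.
  apply: (fil_sum hL) => t _; have Lt := ho _ sx s hx t (ltn_ord t).
  rewrite /act; have [->|ft0] := eqVneq (cf x t) 0.
    by rewrite mulr0 mod0p peval0 mul0mx; apply: (fil0 hL).
  have [nh vh] := af_mul hv hL c_field c_norm hAF pn0 ft0 psz (sx t).
  have nf := hnz _ ft0 (sx t).
  have Ln : L (s - value (cf x t)) (n t).
    by apply: (value_down hL c_field c_norm nf); [case: (hn t (ltn_ord t))|rewrite subrK].
  have := value_up hL c_field c_norm nh Ln; rewrite vh.
  by apply: (filW hL); lia.
have one_small : (size (1 : {poly F})%R <= rho)%N by rewrite size_poly1.
have Ginv (p : {poly F}) : p %% phi != 0 -> exists p' : {poly F}, [/\ p' != 0, (size p' <= rho)%N,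
    value p' = - value (p %% phi) & agree_on L (peval G p' *m peval G p) 1%:M].
  move=> pn0; have sz := size_modphi hAF p.
  have [p' sp' hp'] := af_div hAF pn0 sz one_small.
  have p'0 : p' != 0.
    apply: contraTneq (oner_neq0 {poly F}) => p'0.
    by move: hp'; rewrite p'0 mul0r mod0p => <-; rewrite eqxx.
  exists p'; split=> //.
    have [_] := af_mul hv hL c_field c_norm hAF p'0 pn0 sp' sz.
    rewrite hp' -[1]/(1%:P) (valueC hv hL c_field c_norm) ?oner_neq0 //.
    by rewrite (val_1 hv) mulr0; lia.
  move=> s x hx; rewrite -pevalM (Gmod _ s x hx).
  by rewrite -modp_mul hp' peval1.
have [x1 [x1W x10]] := exists_nonzero c_field.
have k0 : (0 < k)%N.
  rewrite lt0n; apply/eqP => k0; have [_ ex] := hcf _ x1W.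
  by move: x10; rewrite ex k0 /comb big_ord0 eqxx.
exists G; split.
- move=> s x hx; have [sx ex] := hcf x (ex_intro _ s hx).
  rewrite ex in hx *; rewrite mulmxBl GE // mulmx_sumr -sumrB.
  apply: (fil_sum hL) => t _; have Lt := ho _ sx s hx t (ltn_ord t).
  rewrite /act; move: (cf x t) (sx t) Lt => f sf Lt.
  case: (boolP (f == 0)) => [/eqP ->|f0].
    by rewrite mulr0 mod0p !peval0 !mul0mx mulmx0 subrr; apply: (fil0 hL).
  rewrite (modphi_X r0 sp mp sf); set lam := f`_rho.-1.
  have -> : A ('X * f - lam *: phi) *m n t - c *m (A f *m n t) = - (lam *: (A phi *m n t)).
    by rewrite pevalB pevalM pevalX pevalZ mulmxBl -mulmxA -scalemxAl addrAC subrr sub0r.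
  apply: (filN hv hL).
  have [->|lam0] := eqVneq lam 0; first by rewrite scale0r; apply: (fil0 hL).
  have nf := hnz _ f0 sf.
  (* A correction by [phi] occurs only if [f] has degree rho - 1. Then f / lam is monic of that
     degree, whence value f <= e v(lam) + mu, and lam phi(c) [n t] lies at depth at least s + value
     phi - mu >= s - r. *)
  have szf : size f = rho.
    apply/eqP; rewrite eqn_leq sf /= leqNgt; apply: contra lam0 => lt.
    by rewrite /lam nth_default // -ltnS prednK.
  have linv : lam^-1 != 0 by rewrite invr_eq0.
  have fE : f = lam *: (lam^-1 *: f) by rewrite scalerA divff // scale1r.
  have vf : value f <= e * v lam + mu.
    rewrite {1}fE (valueZ hv hL c_field c_norm) // ?lerD2l; last exact: (nzZ hL c_field c_norm).
    apply: hmu; last by rewrite size_scale.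
    by rewrite monicE lead_coefZ lead_coefE szf mulVf.
  have Ln : L (s - value f) (n t).
    by apply: (value_down hL c_field c_norm nf); [case: (hn t (ltn_ord t))|rewrite subrK].
  have := filZ hL lam0 (value_up hL c_field c_norm nphi Ln).
  apply: (filW hL); move: hphi vf; move: (value f) (value phi) (e * v lam) => a b d; lia.
- split; first by case: c_field.
  move=> p; have [h0|h0] := eqVneq (p %% phi) 0; last first.
    by right; have [p' [_ _ _ hp']] := Ginv p h0; exists p'.
  by left=> s x hx; rewrite (Gmod _ s x hx) h0 peval0.
- move=> p np; have h0 : p %% phi != 0.
    by apply/eqP => h0; apply: np => s x hx; rewrite (Gmod _ s x hx) h0 peval0.
  have [p' [p'0 sp' vp' hp']] := Ginv p h0.
  exists (value (p %% phi)) => s x; split=> [hx|[y [hy ->]]]; last first.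
    by rewrite (Gmod p s y hy); apply: (Gsim _ h0 (size_modphi hAF p)).
  exists (peval G p' *m x); split; last first.
    by rewrite mulmxA pevalMC (hp' _ _ hx) mul1mx.
  by have := Gsim _ p'0 sp' _ _ hx; rewrite vp' addrK.
- split.
    by exists phi; split=> // s x hx; rewrite (Gmod _ s x hx) modpp peval0.
  move=> p mp' h; rewrite ltnNge; apply/negP => sz.
  have h0 : p %% phi != 0 by rewrite (modphi_id hAF sz) monic_neq0.
  have [p' [_ _ _ hp']] := Ginv p h0.
  have [s hx] := x1W; move: x10.
  by rewrite -[x1]mul1mx -(hp' _ _ hx) -mulmxA (h _ _ hx) mul0mx mulmx0 eqxx.
Qed.
End Refinement.

Theorem simple_commutation (F : fieldType) (v : F -> int) (pi : F) (m : nat)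
  (L : int -> 'cV[F]_m -> Prop) (e q r : int) (c x : 'M[F]_m) :
  discrete_valuation v pi -> filtration v e L ->
  simple v pi L q r c -> ~ zero_stratum q r c ->
  aset L 0 x -> aset L (- r) (x *m c - c *m x) ->
  forall f, nz L c f -> good L c x f.
Proof.
move=> hv hL [_ [//|[hpure hmin]]] _ x0 xr f0 nf0; apply: contrapT => bf0.
have [[_ r0 rq cq] c_field c_norm [_ nuc] qr] := hpure.
have [rho [phi [hAF nphi bphi hgood]]] := minimal_bad hv hL c_field c_norm x0 nf0 bf0.
have [rho0 sp mp hnz hmul] := hAF.
have [M hM] := optimal_ex hv hL c_field c_norm hAF.
have r1 : (rho.-1 < rho)%N by lia.
have [mM sM Mmax] := hM _ r1.
have xr' : aset L (- r) (comm c x 'X) by rewrite /comm pevalX.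
have bound := comm_bound hv hL c_field c_norm hAF hM xr'.
have hphi : value L c (M rho.-1) - r <= value L c phi.
  rewrite leNgt; apply/negP => lt; apply: bphi.
  by apply: (asetW hL) bound; lia.
have hmu (f : {poly F}) : f \is monic -> size f = rho -> value L c f <= value L c (M rho.-1).
  by move=> mf sf; apply: Mmax => //; rewrite sf prednK.
have [G [Gc G_field G_norm G_deg]] :=
  degree_reduction hv hL c_field c_norm hAF hmu nphi hphi.
have equivP j a : aset L (- r - j%:Z) (a - c) <-> aset L (- r - j%:Z) (a - G).
  have Gcj : aset L (- r - j%:Z) (G - c) by apply: (asetW hL) Gc; lia.
  split=> h.
    have -> : a - G = (a - c) - (G - c) by rewrite opprB addrA subrK.
    exact: (asetB hv hL).
  have -> : a - c = (a - G) + (G - c) by rewrite addrA subrK.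
  exact: (asetD hL).
have Gr : aset L (- q) (G - c) by apply: (asetW hL) Gc; lia.
have Gq : aset L (- q) G.
  by rewrite -[G](subrK c); apply: (asetD hL).
have Gpure : pure v pi L q r G.
  split=> //; first by have [[hl _ _ _] _ _ _ _] := hpure.
  (* As -q < -r, a perturbation in a_{-r} cannot change the exact value -q. *)
  split=> // Gq1; apply: nuc; rewrite -[c](subKr G).
  by apply: (asetB hv hL) => //; apply: (asetW hL) Gc; lia.
have hP : exists k, `[< exists p : {poly F},
    [/\ p \is monic, agree_on L (peval c p) 0 & size p = k] >].
  have [p mp' hp] := peval_annihilator c.
  exists (size p); apply/asboolP; exists p; split=> // s y _.
  by rewrite hp.
case: (ex_minnP hP) => k /asboolP [p [mp' hp sk]] kmin.
have p0 := monic_neq0 mp'.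
have k0 : (0 < k)%N by rewrite -sk size_poly_gt0.
have cdeg : ext_degree L c k.-1.
  split; first by exists p; split=> //; rewrite sk prednK.
  by move=> p' mp'' hp'; rewrite prednK //; apply: kmin; apply/asboolP; exists p'.
(* Minimality gives [k.-1 <= rho]. The remainder of [phi] modulo the minimal polynomial [p] of [c]
   therefore has size at most [rho] and is good; it agrees with [phi] on the span, so [phi] would be
   good too. *)
have := hmin _ _ _ _ Gpure equivP _ _ cdeg G_deg.
rewrite leqNgt => /negP; apply; rewrite ltnNge; apply/negP => le.
apply: bphi.
have ag : agree_on L (peval c phi) (peval c (phi %% p)).
  move=> s y hy; rewrite {1}(divp_eq phi p) pevalD pevalM mulmxDl -mulmxA.
  by rewrite (hp _ _ hy) mul0mx mulmx0 add0r.
apply: (agree_good hv hL c_field c_norm x0 nphi ag); apply: hgood.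
  apply/eqP => h0; apply: nphi => s y hy; rewrite (ag _ _ hy) h0.
  by rewrite peval0.
rewrite -ltnS; apply: (@leq_trans (size p)); first by rewrite ltn_modp.
by rewrite sk; lia.
Qed.

(** * Independence over the residue field *)

Section ResidueIndependence.
Variables (F : fieldType) (v : F -> int) (pi : F).
Hypothesis hv : discrete_valuation v pi.

(** Divide by a coefficient of least valuation. *)
Lemma primitive_scaling k (a : nat -> F) : (exists2 t, (t < k)%N & a t != 0) ->
  exists b, (forall t, (t < k)%N -> in_oF v (b * a t)) /\
    exists2 t, (t < k)%N & ~ in_pF v (b * a t).
Proof.
move=> [t0 t0k at0].
pose T (s : int) := exists t, [/\ (t < k)%N, a t != 0 & s = - v (a t)].
have [|s [t [tk an ->]]|s [[t [tk an ->]] tmax]] :=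
    @int_has_max T (\sum_(t < k) `|v (a t)|).
- by exists (- v (a t0)), t0.
- rewrite (bigD1 (Ordinal tk)) //=.
  have : 0 <= \sum_(i < k | i != Ordinal tk) `|v (a i)| by apply: sumr_ge0.
  by move: (\sum_(i < k | _) _) => S hS; lia.
exists (a t)^-1; split; last first.
  exists t => //; rewrite mulVf // => -[/eqP|]; first by rewrite oner_eq0.
  by rewrite (val_1 hv).
move=> i ik; have [->|ai] := eqVneq (a i) 0; first by rewrite mulr0; left.
right; rewrite (val_M hv) ?invr_eq0 // (val_V hv) //.
have : - v (a i) <= - v (a t) by apply: tmax; exists i.
lia.
Qed.

Variable m : nat.
Implicit Types Lm Ln : 'cV[F]_m -> Prop.

(** Independence over the residue field in Lm / Ln, stated with coefficients in o_F. Indexing by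
    [nat] makes it easy to append a vector. *)
Definition indep Lm Ln k := exists y : nat -> 'cV[F]_m,
  (forall t, (t < k)%N -> Lm (y t)) /\
  forall a : nat -> F, (forall t, in_oF v (a t)) -> Ln (\sum_(t < k) a t *: y t) ->
    forall t, (t < k)%N -> in_pF v (a t).

Record residue_pair Lm Ln : Prop := ResiduePair {
  rpD : forall x y, Ln x -> Ln y -> Ln (x + y);
  rpZ : forall a x, in_oF v a -> Ln x -> Ln (a *: x);
  rpP : forall a x, in_pF v a -> Lm x -> Ln (a *: x);
  rp0 : Ln 0 }.

Lemma rp_sum Lm Ln (hL : residue_pair Lm Ln) (I : Type) (s : seq I) (Q : pred I) f :
  (forall i, Q i -> Ln (f i)) -> Ln (\sum_(i <- s | Q i) f i).
Proof.
by move=> h; apply: (big_ind Ln) => //; [exact: (rp0 hL)|exact: (rpD hL)].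
Qed.

(** A linear relation over F, scaled to be primitive, remains nontrivial over the residue field;
    this brings dimension counts back to F. *)
Lemma kernel_primitive k l (M : nat -> nat -> F) : (l < k)%N ->
  exists w : nat -> F, [/\ forall t, in_oF v (w t),
    exists2 t, (t < k)%N & ~ in_pF v (w t) &
    forall j, (j < l)%N -> \sum_(t < k) w t * M t j = 0].
Proof.
move=> lk; have [a a0 aM] := nontrivial_kernel (\matrix_(t < k, j < l) M t j) lk.
pose a' t := oapp (fun t : 'I_k => a 0 t) 0 (insub t).
have a'E (t : 'I_k) : a' t = a 0 t by rewrite /a' valK.
have [|b [bo [t tk bp]]] := @primitive_scaling k a'.
  apply: contrapT => h; case/eqP: a0; apply/rowP => t; rewrite [RHS]mxE.
  by apply/eqP; apply: contraT => at0; case: h; exists t; rewrite ?a'E.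
exists (fun t => b * a' t); split; last 2 first.
- by exists t.
- move=> j jl; under eq_bigr => i _ do rewrite -mulrA.
  rewrite -mulr_sumr; apply/eqP; rewrite mulf_eq0; apply/orP; right; apply/eqP.
  have E : (a *m \matrix_(t < k, j < l) M t j) 0 (Ordinal jl) = 0 by rewrite aM mxE.
  rewrite -[RHS]E mxE.
  by apply: eq_bigr => i _; rewrite mxE a'E.
move=> i; have [ik|ki] := ltnP i k; first exact: bo.
by rewrite /a' insubF ?mulr0; [left|rewrite ltnNge ki].
Qed.

Lemma indep_bound Lm Ln k : residue_pair Lm Ln -> indep Lm Ln k -> (k <= m)%N.
Proof.
move=> hL [y [hy hi]]; rewrite leqNgt; apply/negP => mk.
have [w [wo [t tk wp] ker]] := kernel_primitive
  (fun t j => oapp (fun i : 'I_m => y t i 0) 0 (insub j)) mk.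
apply: wp; apply: hi => //; suff -> : \sum_(t < k) w t *: y t = 0 by apply: (rp0 hL).
apply/colP => i; rewrite summxE [RHS]mxE -[RHS](ker i) //; apply: eq_bigr => j _.
by rewrite mxE valK.
Qed.

(** Steinitz: with more vectors than generators, the coefficient matrix has a primitive relation,
    which kills the combination modulo [Ln]. *)
Lemma indep_kdim Lm Ln k l : residue_pair Lm Ln ->
  kdim v Lm Ln l -> indep Lm Ln k -> (k <= l)%N.
Proof.
move=> hL [x [hx _ hgen]] [y [hy hi]]; rewrite leqNgt; apply/negP => lk.
have [C hC] : exists C : nat -> 'I_l -> F, forall t, (t < k)%N ->
    (forall i, in_oF v (C t i)) /\ Ln (y t - \sum_i C t i *: x i).
  suff /choice[C hC] : forall t, exists C : 'I_l -> F, (t < k)%N ->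
    (forall i, in_oF v (C i)) /\ Ln (y t - \sum_i C i *: x i) by exists C.
  move=> t; have [tk|] := boolP (t < k)%N; last by exists (fun=> 0).
  by have [C hC] := hgen _ (hy t tk); exists C.
have [w [wo [t tk wp] ker]] := kernel_primitive
  (fun t j => oapp (C t) 0 (insub j)) lk.
apply: wp; apply: hi => //.
have -> : \sum_(t < k) w t *: y t =
    \sum_(t < k) w t *: (y t - \sum_i C t i *: x i).
  under [RHS]eq_bigr => i _ do rewrite scalerBr.
  rewrite sumrB; suff -> : \sum_(i < k) w i *: (\sum_j C i j *: x j) = 0.
    by rewrite subr0.
  under eq_bigr => i _ do rewrite scaler_sumr.
  rewrite exchange_big big1 //= => j _.
  under eq_bigr => i _ do rewrite scalerA.
  rewrite -scaler_suml; have := ker j (ltn_ord j).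
  by under eq_bigr => i _ do rewrite valK /=; move=> ->; rewrite scale0r.
apply: (rp_sum hL) => i _; apply: (rpZ hL) => //; exact: (hC i (ltn_ord i)).2.
Qed.

Lemma kdim_indep Lm Ln k : kdim v Lm Ln k -> indep Lm Ln k.
Proof.
move=> [x [hx hi _]]; exists (fun t => oapp x 0 (insub t)); split.
  by move=> t tk; rewrite insubT /=.
move=> a ao; under eq_bigr => i _ do rewrite valK /=.
by move=> /(hi (fun t => a t) (fun t => ao t)) h t tk; apply: (h (Ordinal tk)).
Qed.

Lemma indep_leq Lm Ln k l : (l <= k)%N -> indep Lm Ln k -> indep Lm Ln l.
Proof.
move=> lk [y [hy hi]]; exists y; split=> [t tl|a ao ha t tl].
  by apply: hy; apply: leq_trans lk.
have := hi (fun t => if (t < l)%N then a t else 0) _ _ t (leq_trans tl lk).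
rewrite tl; apply; first by move=> i; case: ifP => // _; left.
rewrite -(subnKC lk) big_split_ord /= [X in _ + X]big1 ?addr0; last first.
  by move=> i _; rewrite ltnNge leq_addr /= scale0r.
suff <- : \sum_(t < l) a t *: y t =
  \sum_(i < l) (if (i < l)%N then a i else 0) *: y i by [].
by apply: eq_bigr => i _; rewrite ltn_ord.
Qed.

(** A maximal independent family generates. In a relation involving a vector it does not generate,
    the coefficient of that vector lies in p_F, as otherwise dividing by this unit would express the
    vector. *)
Lemma kdim_ex Lm Ln : residue_pair Lm Ln -> exists k, kdim v Lm Ln k.
Proof.
move=> hL.
have I0 : exists k, indep Lm Ln k by exists 0%N, (fun=> 0); split.
have [k [[y [hy hi]] kmax]] := nat_has_max I0 (fun k => indep_bound hL).
exists k, (fun t => y t); split=> //.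
- by move=> t; apply: hy.
- move=> a ao ha t.
  have aE (i : 'I_k) : oapp a 0 (insub (i : nat)) = a i by rewrite valK.
  rewrite -aE; apply: (hi (fun t => oapp a 0 (insub t))) => //.
    by move=> i; case: insub => [j|] /=; [exact: ao|left].
  by under eq_bigr => i _ do rewrite aE.
move=> z hz; apply: contrapT => nz.
suff /kmax : indep Lm Ln k.+1 by rewrite ltnn.
exists (fun t => if t == k then z else y t); split.
  move=> t; rewrite ltnS leq_eqVlt; case: eqVneq => [_ _ //|_ /= tk]; exact: hy.
move=> a ao; rewrite big_ord_recr /= eqxx.
under eq_bigr => i _ do rewrite ltn_eqF //.
move=> hs; have ak : in_pF v (a k).
  apply: contrapT => nak; apply: nz.
  have ak0 : a k != 0 by apply/eqP => h; apply: nak; left.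
  have vak : v (a k) = 0.
    have h0 := vge_val ak0 (ao k); apply: le_anti; rewrite h0 andbT leNgt.
    by apply/negP => lt; apply: nak; right; lia.
  have io : in_oF v (a k)^-1 by right; rewrite (val_V hv) // vak.
  exists (fun t => - ((a k)^-1 * a t)); split.
    move=> t; have := vgeM hv io (ao t); rewrite -mulN1r addr0 => h.
    have n1 : in_oF v (-1) by right; rewrite (val_N1 hv).
    by have := vgeM hv n1 h; rewrite addr0.
  under eq_bigr => i _ do rewrite scaleNr -scalerA.
  rewrite sumrN opprK -scaler_sumr.
  have := rpZ hL io hs; rewrite scalerDr scalerA mulVf // scale1r.
  by rewrite addrC.
have hk : Ln (\sum_(i < k) a i *: y i).
  rewrite -(addrK (a k *: z) (\sum_(i < k) _)); apply: (rpD hL) => //.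
  rewrite -scaleN1r; apply: (rpZ hL); last exact: (rpP hL).
  by right; rewrite (val_N1 hv).
by move=> t; rewrite ltnS leq_eqVlt => /orP[/eqP -> //|tk]; apply: (hi a).
Qed.
End ResidueIndependence.

(** Puts equality of dimensions in the form used by the exchange argument below. *)
Lemma equal_kdim_indep (F : fieldType) (v : F -> int) (pi : F) m1 m2
  (L1 L1' : 'cV[F]_m1 -> Prop) (L2 L2' : 'cV[F]_m2 -> Prop) :
  discrete_valuation v pi -> residue_pair v L1 L1' ->
  (forall k, kdim v L1 L1' k -> kdim v L2 L2' k) ->
  forall k, indep v L1 L1' k -> indep v L2 L2' k.
Proof.
move=> hv h1 h k hk; have [l hl] := kdim_ex hv h1.
by apply: indep_leq (kdim_indep (h l hl)); apply: (indep_kdim hv h1 hl).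
Qed.

(** * Pairing two summands *)

Section FieldFiltration.
Variables (F : fieldType) (v : F -> int) (pi : F).
Hypothesis hv : discrete_valuation v pi.
Variables (m : nat) (e : int) (L : int -> 'cV[F]_m -> Prop).
Hypothesis hL : filtration v e L.
Variable c : 'M[F]_m.
Hypothesis c_field : gen_field L c.
Hypothesis c_norm : normalizes L c.
Local Notation A f := (peval c f).
Local Notation W := (fspan L).
Local Notation nz := (nz L c).
Local Notation value := (value L c).

(** The exact case: modulo the minimal polynomial of [c] on the span, taking remainders changes
    nothing, and F[X]/(phi) is E itself. *)
Lemma min_poly_almost_field : exists rho phi,
  almost_field L c rho phi /\ agree_on L (A phi) 0.
Proof.
have hP : exists k, `[< exists p : {poly F},
    [/\ p \is monic, agree_on L (peval c p) 0 & size p = k] >].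
  have [p mp' hp] := peval_annihilator c.
  by exists (size p); apply/asboolP; exists p; split=> // s y _; rewrite hp.
case: (ex_minnP hP) => k /asboolP [p [mp hp sk]] kmin.
have p0 := monic_neq0 mp.
have k1 : (1 < k)%N.
  rewrite ltnNge -sk; apply/negP => /size1_polyC h.
  apply: (nzC c_field (a := p`_0)); last by rewrite -h.
  by apply: contra p0 => /eqP h0; rewrite h h0.
exists k.-1, p; split=> //.
have hnz (f : {poly F}) : f != 0 -> (size f <= k.-1)%N -> nz f.
  move=> f0 sf h; have lf0 : (lead_coef f)^-1 != 0 by rewrite invr_eq0 lead_coef_eq0.
  suff : (k <= size ((lead_coef f)^-1 *: f))%N.
    by rewrite size_scale //; move: sf; move: (size f) => i; lia.
  apply: kmin; apply/asboolP; exists ((lead_coef f)^-1 *: f); split=> //.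
    by rewrite monicE lead_coefZ mulVf // lead_coef_eq0.
  by move=> s x hx; rewrite pevalZ -scalemxAl (h _ _ hx) mul0mx scaler0.
split=> //; [lia|by rewrite sk prednK //; lia|].
move=> f g f0 g0 sf sg.
have nfg := nzM hL c_field c_norm (hnz _ f0 sf) (hnz _ g0 sg).
have ag : agree_on L (A (f * g)) (A ((f * g) %% p)).
  move=> s x hx; rewrite {1}(divp_eq (f * g) p) pevalD pevalM mulmxDl -mulmxA.
  by rewrite (hp _ _ hx) mul0mx mulmx0 add0r.
split; last by move=> s x hx; rewrite mulmxBl (ag _ _ hx) subrr; apply: (fil0 hL).
by apply/eqP => h0; apply: nfg => s x hx; rewrite (ag _ _ hx) h0 peval0.
Qed.

Variables (rho : nat) (phi : {poly F}).
Hypothesis hAF : almost_field L c rho phi.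
Hypothesis hphi : agree_on L (A phi) 0.
Local Notation comb := (comb c).
Local Notation small := (small rho).
Local Notation orth := (orth L c rho).
Local Notation nonzero_family := (nonzero_family L).
Local Notation Tspan := (Tspan c rho).

Section Projection.
Variable p : 'M[F]_m.
Hypothesis p_good : forall f, nz f -> good L c p f.

Lemma orth_term k n f s t : orth k n -> nonzero_family k n -> small f ->
  L s (comb k n f) -> (t < k)%N -> f t != 0 -> L (s - value (f t)) (n t).
Proof.
move=> ho hn sf Ls tk ft0; have [_ _ _ hnz _] := hAF.
apply: (value_down hL c_field c_norm (hnz _ ft0 (sf t))); first by case: (hn t tk).
by rewrite subrK; apply: ho.
Qed.

(** Every coefficient commutes with [p] in the graded algebra and [p] fixes the vectors, so [p]
    moves the combination only by deeper terms. *)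
Lemma proj_comb k n f s : orth k n -> nonzero_family k n -> small f ->
  (forall t, (t < k)%N -> p *m n t = n t) ->
  L s (comb k n f) -> L (s + 1) (p *m comb k n f - comb k n f).
Proof.
move=> ho hn sf hp Ls; rewrite mulmx_sumr -sumrB; apply: (fil_sum hL) => t _.
have tk := ltn_ord t; have [_ _ _ hnz _] := hAF.
have [->|ft0] := eqVneq (f t) 0.
  by rewrite peval0 !mul0mx mulmx0 subrr; apply: (fil0 hL).
have -> : p *m (A (f t) *m n t) - A (f t) *m n t = comm c p (f t) *m n t.
  by rewrite mulmxBl -!mulmxA hp.
have := p_good (hnz _ ft0 (sf t)) (orth_term ho hn sf Ls tk ft0).
by apply: (filW hL); lia.
Qed.
End Projection.

Lemma comb_transfer k n n' f s : orth k n -> nonzero_family k n -> nonzero_family k n' ->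
  (forall t, (t < k)%N -> ord L (n t) = ord L (n' t)) -> small f ->
  L s (comb k n f) -> L s (comb k n' f).
Proof.
move=> ho hn hn' hord sf Ls; apply: (fil_sum hL) => t _.
have tk := ltn_ord t; have [_ _ _ hnz _] := hAF.
have [->|ft0] := eqVneq (f t) 0; first by rewrite peval0 mul0mx; apply: (fil0 hL).
have nf := hnz _ ft0 (sf t).
have [nW n0] := hn t tk; have [n'W n'0] := hn' t tk.
have := orth_term ho hn sf Ls tk ft0 => /(ordP hv hL _ nW n0); rewrite hord // => h.
have Ln' : L (s - value (f t)) (n' t) by apply/(ordP hv hL _ n'W n'0).
by have := value_up hL c_field c_norm nf Ln'; rewrite subrK.
Qed.

Definition projections (p p' : 'M[F]_m) :=
  [/\ aset L 0 p, aset L 0 p', forall x, W x -> p *m x + p' *m x = x,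
      forall x, W x -> p *m (p *m x) = p *m x &
      forall x, W x -> p' *m (p' *m x) = p' *m x].

Lemma projections_sym p p' : projections p p' -> projections p' p.
Proof. by case=> h1 h2 h3 h4 h5; split=> // x xW; rewrite addrC; apply: h3. Qed.

Lemma projections_kill p p' x : projections p p' -> W x -> p *m x = x -> p' *m x = 0.
Proof.
move=> [_ _ h _ _] xW hx; have := h x xW; rewrite hx => /eqP.
by rewrite -subr_eq0 addrAC subrr add0r => /eqP.
Qed.

Lemma projections_good p p' : projections p p' ->
  (forall f, nz f -> good L c p f) -> forall f, nz f -> good L c p' f.
Proof.
move=> [p0 p'0 hs _ _] hg f nf s x hx.
have xW : W x by exists s.
have fW := peval_span hL c_norm f xW.
suff -> : comm c p' f *m x = - (comm c p f *m x) by apply: (filN hv hL); apply: hg.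
have E : p' *m (A f *m x) = A f *m x - p *m (A f *m x).
  by rewrite -{2}(hs _ fW) addrC addKr.
have E' : p' *m x = x - p *m x by rewrite -{2}(hs _ xW) addrC addKr.
rewrite /comm !mulmxBl -!mulmxA E E' mulmxBr !opprB.
by rewrite addrC addrA subrK.
Qed.

Definition paired p p' k n n' :=
  [/\ orth k n /\ orth k n', nonzero_family k n /\ nonzero_family k n',
      forall t, (t < k)%N -> p *m n t = n t,
      forall t, (t < k)%N -> p' *m n' t = n' t &
      forall t, (t < k)%N -> ord L (n t) = ord L (n' t)].

Lemma paired_sym p p' k n n' : paired p p' k n n' -> paired p' p k n' n.
Proof. by case=> -[h1 h2] [h3 h4] h5 h6 h7; split=> // t tk; rewrite h7. Qed.

(** In graded terms: the leading terms of the E-span of [n] include those of the image of [p]. *)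
Definition approximates p k n := forall x s, p *m x = x -> L s x ->
  exists2 u, Tspan k n u & L (s + 1) (x - u).

(** A vector whose leading term is missed by the span has order exactly [s] and is orthogonal to the
    span, hence can extend the family. *)
Lemma missed_order p k n x s : p *m x = x -> L s x ->
  ~ (exists2 u, Tspan k n u & L (s + 1) (x - u)) ->
  [/\ x != 0, ord L x = s & forall u t, Tspan k n u -> L t (x + u) -> L t x].
Proof.
move=> px Lx nap; have [S0 SD SZ] := Tspan_subspace c rho k n.
have x0 : x != 0.
  apply/eqP => x0; apply: nap; exists 0 => //; rewrite x0 subr0; exact: (fil0 hL).
have xW : W x by exists s.
split=> //.
  apply: le_anti; apply/andP; split; last by apply/(ordP hv hL _ xW x0).
  rewrite leNgt; apply/negP => lt; apply: nap; exists 0 => //; rewrite subr0.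
  by apply/(ordP hv hL _ xW x0); lia.
move=> u t Su Lt; have [le|lt] := lerP t s; first exact: (filW hL) le Lx.
case: nap; exists (- u); first by rewrite -scaleN1r; apply: SZ.
by rewrite opprK; apply: (filW hL) Lt; lia.
Qed.

Lemma restrict_residue p s : residue_pair v (restrict L p s) (restrict L p (s + 1)).
Proof.
split.
- move=> x y [hx px] [hy py]; split; first exact: (filD hL).
  by rewrite mulmxDr px py.
- move=> a x ha [hx px]; split; first exact: (fil_oF hL).
  by rewrite -scalemxAr px.
- move=> a x ha [hx px]; split; first exact: (fil_pF hL).
  by rewrite -scalemxAr px.
- by split; [apply: (fil0 hL)|rewrite mulmx0].
Qed.

Lemma in_oF_residue a : in_oF v a -> ~ in_pF v a -> a != 0 /\ in_oF v a^-1.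
Proof.
move=> ho hp; have a0 : a != 0 by apply/eqP => h; apply: hp; left.
split=> //; right; rewrite (val_V hv) //; have h0 := vge_val a0 ho.
by rewrite oppr_ge0 leNgt; apply/negP => lt; apply: hp; right; lia.
Qed.

(** A dimension count at level [s]. If the E-span of [n'] gave all leading terms of the image of
    [p'], a maximal independent family there could be carried to the image of [p] by using the same
    coefficients on [n]; with [x] added it would be independent and too large. *)
Lemma transfer_missed p p' k n n' x s : projections p p' ->
  (forall f, nz f -> good L c p f) -> paired p p' k n n' ->
  (forall l, indep v (restrict L p s) (restrict L p (s + 1)) l ->
     indep v (restrict L p' s) (restrict L p' (s + 1)) l) ->
  p *m x = x -> L s x -> ~ (exists2 u, Tspan k n u & L (s + 1) (x - u)) ->
  exists x', [/\ p' *m x' = x', L s x' &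
    ~ (exists2 u, Tspan k n' u & L (s + 1) (x' - u))].
Proof.
move=> hpp hg [[ho ho'] [hn hn'] hp hp' hord] hind px Lx nap.
have [p0 p'0 hsum pp pp'] := hpp.
apply: contrapT => none.
have app' y : p' *m y = y -> L s y -> exists2 u, Tspan k n' u & L (s + 1) (y - u).
  by move=> py Ly; apply: contrapT => ny; apply: none; exists y.
have rp' := restrict_residue p' s.
have I0 : exists l, indep v (restrict L p' s) (restrict L p' (s + 1)) l.
  by exists 0%N, (fun=> 0); split.
have [K [[y [hy hi]] Kmax]] := nat_has_max I0 (fun l => indep_bound hv rp').
have [g hgy] : exists g : nat -> nat -> {poly F}, forall t, (t < K)%N ->
    small (g t) /\ L (s + 1) (y t - comb k n' (g t)).
  suff /choice[g hgy] : forall t, exists f : nat -> {poly F}, (t < K)%N ->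
    small f /\ L (s + 1) (y t - comb k n' f) by exists g.
  move=> t; have [tK|] := boolP (t < K)%N; last by exists (fun=> 0).
  have [Ly py] := hy t tK.
  by have [u [f sf ->] hf] := app' _ py Ly; exists f.
(* Equal coefficients on both families; as orders agree, [u] and [u'] lie at the same levels. Since
   [u t] need not be fixed by [p], its projection [z t] is used, which has the same leading term. *)
pose u t := comb k n (g t); pose u' t := comb k n' (g t).
have Lu' t : (t < K)%N -> L s (u' t).
  move=> tK; have [Ly _] := hy t tK; have [_ h] := hgy t tK.
  rewrite -[u' t](subKr (y t)); apply: (filB hv hL) => //.
  by apply: (filW hL) h; lia.
have Lu t : (t < K)%N -> L s (u t).
  move=> tK; have [sg _] := hgy t tK.
  by apply: (comb_transfer ho' hn' hn _ sg); [move=> i ik; rewrite hord|apply: Lu'].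
pose z t := p *m u t.
have Lz t : (t < K)%N -> L (s + 1) (z t - u t).
  by move=> tK; have [sg _] := hgy t tK; exact: (proj_comb hg ho hn sg hp (Lu t tK)).
suff /hind/Kmax : indep v (restrict L p s) (restrict L p (s + 1)) K.+1.
  by rewrite ltnn.
exists (fun t => if t == K then x else z t); split.
  move=> t; rewrite ltnS leq_eqVlt; case: eqVneq => [_ _|_ /= tK]; first by split.
  split; first by have := p0 _ _ (Lu t tK); rewrite addr0.
  by apply: pp; exists s; apply: Lu.
move=> a ao; rewrite big_ord_recr /= eqxx.
under eq_bigr => i _ do rewrite ltn_eqF //.
move=> [hs _].
have aS (w w' : nat -> 'cV[F]_m) : (forall t, (t < K)%N -> L (s + 1) (w t - w' t)) ->
    L (s + 1) (\sum_(t < K) a t *: w t - \sum_(t < K) a t *: w' t).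
  move=> hw; rewrite -sumrB; apply: (fil_sum hL) => t _; rewrite -scalerBr.
  by apply: (fil_oF hL) => //; apply: hw.
have sumE w : \sum_(t < K) a t *: comb k w (g t) =
    comb k w (fun i => \sum_(t < K) a t *: g t i).
  under eq_bigr => t _ do rewrite scaler_sumr.
  rewrite exchange_big; apply: eq_bigr => i _ /=.
  rewrite peval_sum mulmx_suml; apply: eq_bigr => t _.
  by rewrite pevalZ scalemxAl.
have ssum : small (fun i => \sum_(t < K) a t *: g t i).
  move=> i; apply: leq_trans (size_sum _ _ _) _; apply/bigmax_leqP => t _.
  by apply: leq_trans (size_scale_leq _ _) _; have [] := hgy t (ltn_ord t).
have hu : L (s + 1) (\sum_(t < K) a t *: u t + a K *: x).
  have -> : \sum_(t < K) a t *: u t + a K *: x =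
     (\sum_(t < K) a t *: z t + a K *: x) - (\sum_(t < K) a t *: z t - \sum_(t < K) a t *: u t).
    by rewrite opprB [RHS]addrC addrA subrK.
  by apply: (filB hv hL) => //; apply: aS.
(* Were this coefficient a unit, dividing by it would approximate [x] by the span of [n]. *)
have aK : in_pF v (a K).
  apply: contrapT => /(in_oF_residue (ao K))[aK0 aKo]; apply: nap.
  exists (- ((a K)^-1 *: \sum_(t < K) a t *: u t)).
    have [_ _ SZ] := Tspan_subspace c rho k n.
    rewrite -scaleN1r; apply: (SZ); apply: (SZ); rewrite /u sumE.
    by exists (fun i => \sum_(t < K) a t *: g t i).
  have := fil_oF hL aKo hu; rewrite scalerDr scalerA mulVf // scale1r.
  by rewrite opprK [_ *: _ + x]addrC.
have hu0 : L (s + 1) (\sum_(t < K) a t *: u t).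
  rewrite -(addrK (a K *: x) (\sum_(t < K) _)); apply: (filB hv hL) => //.
  exact: (fil_pF hL).
(* The relation among the [u t] is carried back to the [u' t], which agree with the [y t] modulo
   level s + 1. *)
have hy0 : L (s + 1) (\sum_(t < K) a t *: y t).
  rewrite -(subrK (\sum_(t < K) a t *: u' t) (\sum_(t < K) a t *: y t)).
  apply: (filD hL); first by apply: aS => t tK; have [] := hgy t tK.
  rewrite /u' sumE; apply: (comb_transfer ho hn hn') => //.
  by rewrite -sumE.
move=> t; rewrite ltnS leq_eqVlt => /orP[/eqP -> //|tK].
apply: hi => //; split=> //.
rewrite mulmx_sumr; apply: eq_bigr => i _; rewrite -scalemxAr.
by have [_ ->] := hy i (ltn_ord i).
Qed.

Lemma paired_extend p p' k n n' x x' s : paired p p' k n n' ->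
  p *m x = x -> L s x -> ~ (exists2 u, Tspan k n u & L (s + 1) (x - u)) ->
  p' *m x' = x' -> L s x' -> ~ (exists2 u, Tspan k n' u & L (s + 1) (x' - u)) ->
  paired p p' k.+1 (extend n k x) (extend n' k x').
Proof.
move=> [[ho ho'] [hn hn'] hp hp' hord] px Lx nx px' Lx' nx'.
have [x0 xs xb] := missed_order px Lx nx; have [x'0 x's x'b] := missed_order px' Lx' nx'.
have [h1 h2] := orth_extendP hv hL c_field c_norm hAF ho hn (ex_intro _ s Lx) x0 xb.
have [h3 h4] := orth_extendP hv hL c_field c_norm hAF ho' hn' (ex_intro _ s Lx') x'0 x'b.
by split=> // t; rewrite ltnS leq_eqVlt /extend; case: eqVneq => [_ _|_ /= tk];
  rewrite ?xs ?x's //; auto.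
Qed.

(** For paired families of maximal length, a vector missed on either side yields one of the same
    order missed on the other, and the two together would lengthen the pair. *)
Lemma paired_ex p p' : projections p p' -> (forall f, nz f -> good L c p f) ->
  (forall s l, indep v (restrict L p s) (restrict L p (s + 1)) l <->
     indep v (restrict L p' s) (restrict L p' (s + 1)) l) ->
  exists k n n', [/\ paired p p' k n n', approximates p k n & approximates p' k n'].
Proof.
move=> hpp hg hind; have hg' := projections_good hpp hg.
pose Q k := exists n n', paired p p' k n n'.
have Q0 : exists k, Q k by exists 0%N, (fun=> 0), (fun=> 0); split.
have Qm k : Q k -> (k <= m)%N.
  by move=> [n [n' [[ho _] [hn _] _ _ _]]]; apply: (orth_bound hv hL c_field hAF ho hn).
have [k [[n [n' hpair]] kmax]] := nat_has_max Q0 Qm.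
exists k, n, n'; split=> // x s px Lx; apply: contrapT => nx.
  have [x' [px' Lx' nx']] := transfer_missed hpp hg hpair (fun l => (hind s l).1) px Lx nx.
  suff /kmax : Q k.+1 by rewrite ltnn.
  by exists (extend n k x), (extend n' k x'); apply: paired_extend nx'.
have [x' [px' Lx' nx']] := transfer_missed (projections_sym hpp) hg' (paired_sym hpair)
  (fun l => (hind s l).2) px Lx nx.
suff /kmax : Q k.+1 by rewrite ltnn.
by exists (extend n k x'), (extend n' k x); apply: paired_extend nx.
Qed.

Lemma comb_X k n f : nonzero_family k n ->
  c *m comb k n f = comb k n (fun t => ('X * f t) %% phi).
Proof.
move=> hn; rewrite mulmx_sumr; apply: eq_bigr => t _.
have [[s hs] _] := hn t (ltn_ord t).
have fW : W (A (('X * f t) %/ phi) *m n t).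
  by apply: (peval_span hL c_norm); exists s.
have -> : c *m (A (f t) *m n t) = A ('X * f t) *m n t by rewrite pevalM pevalX mulmxA.
rewrite {1}(divp_eq ('X * f t) phi) pevalD pevalM mulmxDl -mulmxA (hphi hs).
by rewrite mul0mx mulmx0 add0r.
Qed.

(** The families [n] and [n'] together span the whole space over E. The E-linear map [U] sends [n]
    to [n'] and kills [n']; composing with [p'] puts its image in the right summand and changes
    leading terms of combinations of [n'] not at all. *)
Lemma isometry_ex p p' b r : projections p p' -> (forall f, nz f -> good L c p f) ->
  (forall s l, indep v (restrict L p s) (restrict L p (s + 1)) l <->
     indep v (restrict L p' s) (restrict L p' (s + 1)) l) ->
  aset L (- r) (b - c) -> (forall x, W x -> p' *m (b *m x) = b *m (p' *m x)) ->
  (forall x, W x -> W (b *m x)) ->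
  exists G : 'M[F]_m, forall x, W x -> p *m x = x ->
    [/\ p' *m (G *m x) = G *m x, forall s, L s x <-> L s (G *m x) &
        forall s, L s x -> L (s - r) (G *m (b *m x) - b *m (G *m x))].
Proof.
move=> hpp hg hind hbc pb bW; have hg' := projections_good hpp hg.
have [k [n [n' [hpair happ happ']]]] := paired_ex hpp hg hind.
have [[ho ho'] [hn hn'] hp hp' hord] := hpair.
have [p_int p'_int hsum pp pp'] := hpp.
have cW f : W (comb k n f) by apply: (comb_span hL c_norm).
have cW' f : W (comb k n' f) by apply: (comb_span hL c_norm).
have kill f s : small f -> L s (comb k n f) -> L (s + 1) (p' *m comb k n f).
  move=> sf Ls; have -> : p' *m comb k n f = - (p *m comb k n f - comb k n f).
    by rewrite opprB -{2}(hsum _ (cW f)) addrC addKr.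
  by apply: (filN hv hL); apply: (proj_comb hg ho hn sf hp Ls).
have kill' f s : small f -> L s (comb k n' f) -> L (s + 1) (p *m comb k n' f).
  move=> sf Ls; have -> : p *m comb k n' f = - (p' *m comb k n' f - comb k n' f).
    by rewrite opprB -{2}(hsum _ (cW' f)) addrK.
  by apply: (filN hv hL); apply: (proj_comb hg' ho' hn' sf hp' Ls).
(* If the first part had order o < s, both parts would lie in [L o]. Applying [p] preserves the
   leading term of the first and pushes the second to level o + 1, so the first would lie at level o
   + 1 as well. *)
have orth2 f f' s : small f -> small f' -> L s (comb k n f + comb k n' f') ->
    L s (comb k n f).
  move=> sf sf' Ls; apply: contrapT => nLs.
  have C0 : comb k n f != 0 by apply/eqP => h; apply: nLs; rewrite h; apply: (fil0 hL).
  have ho1 t := ordP hv hL t (cW f) C0; set o := ord L (comb k n f) in ho1.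
  have os : o < s by rewrite ltNge; apply/negP => /ho1.
  have Lo : L o (comb k n f) by apply/ho1.
  have Lo' : L o (comb k n' f').
    rewrite -(addKr (comb k n f) (comb k n' f')); apply: (filD hL).
      exact: (filN hv hL).
    by apply: (filW hL) Ls; lia.
  have h1 : L (o + 1) (p *m (comb k n f + comb k n' f')).
    have := p_int _ _ Ls; rewrite addr0; apply: (filW hL); lia.
  have : L (o + 1) (comb k n f).
    have -> : comb k n f = p *m (comb k n f + comb k n' f') - p *m comb k n' f'
        - (p *m comb k n f - comb k n f) by rewrite mulmxDr addrK subKr.
    apply: (filB hv hL); last exact: (proj_comb hg ho hn sf hp Lo).
    by apply: (filB hv hL) => //; apply: kill'.
  by move/ho1; lia.
pose S x := exists f f', [/\ small f, small f' & x = comb k n f + comb k n' f'].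
have hS : subspace S.
  have s0 := @small0 F rho; split.
  - by exists (fun=> 0), (fun=> 0); rewrite !comb0 addr0.
  - move=> x y [f [f' [sf sf' ->]]] [g [g' [sg sg' ->]]].
    exists (fun t => 1 *: f t + g t), (fun t => 1 *: f' t + g' t).
    by rewrite -!comb_linear !scale1r addrACA; split=> //; apply: small_linear.
  - move=> a x [f [f' [sf sf' ->]]].
    exists (fun t => a *: f t + (fun=> 0) t), (fun t => a *: f' t + (fun=> 0) t).
    by rewrite -!comb_linear !comb0 !addr0 scalerDr; split=> //; apply: small_linear.
have [_ WD WZ] := fspan_subspace hL.
have full x : W x -> S x.
  apply: (approx_full hv hL (Q := fun=> True)) => //.
    by move=> u [f [f' [_ _ ->]]]; split=> //; apply: WD.
  move=> {}x s _ Ls; have xW : W x by exists s.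
  have [u [f sf uE] hu] : exists2 u, Tspan k n u & L (s + 1) (p *m x - u).
    by apply: happ; [apply: pp|have := p_int _ _ Ls; rewrite addr0].
  have [u' [f' sf' u'E] hu'] : exists2 u, Tspan k n' u & L (s + 1) (p' *m x - u).
    by apply: happ'; [apply: pp'|have := p'_int _ _ Ls; rewrite addr0].
  exists (u + u'); first by exists f, f'; rewrite -uE -u'E.
  by rewrite -{1}(hsum x xW) opprD addrACA; apply: (filD hL).
have [cf hcf] : exists cf : 'cV[F]_m -> nat -> {poly F}, forall x, W x ->
    small (cf x) /\ exists2 f', small f' & x = comb k n (cf x) + comb k n' f'.
  suff /choice[cf hcf] : forall x, exists f : nat -> {poly F}, W x ->
    small f /\ exists2 f', small f' & x = comb k n f + comb k n' f' by exists cf.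
  move=> x; have [xW|nx] := pselect (W x); last by exists (fun=> 0).
  by have [f [f' [sf sf' ex]]] := full x xW; exists f => _; split=> //; exists f'.
have cfU f f' t : small f -> small f' -> (t < k)%N ->
    cf (comb k n f + comb k n' f') t = f t.
  move=> sf sf' tk; have xW := WD _ _ (cW f) (cW' f').
  have [s1 [g sg e1]] := hcf _ xW.
  apply/eqP; rewrite -subr_eq0; apply/eqP.
  set h := cf _ in s1 e1 *.
  pose d t := (-1) *: f t + h t; pose d' t := (-1) *: f' t + g t.
  have sd : small d by apply: small_linear.
  have sd' : small d' by apply: small_linear.
  have z0 : comb k n d + comb k n' d' = 0.
    by rewrite -!comb_linear addrACA -e1 -scalerDr scaleN1r addNr.
  have zd : comb k n d = 0.
    apply: (fil_sep hv hL) => s; apply: (orth2 d d' s sd sd').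
    by rewrite z0; apply: (fil0 hL).
  have := orth_eq0 hv hL c_field hAF ho hn sd zd tk.
  by rewrite /d scaleN1r addrC.
have combE (f f' : nat -> {poly F}) l : (forall t, (t < k)%N -> f t = f' t) ->
    comb k l f = comb k l f'.
  by move=> h; apply: eq_bigr => t _; rewrite h.
have [U hU] : exists U : 'M[F]_m, forall x, W x -> U *m x = comb k n' (cf x).
  apply: (subspace_linear_mx (fspan_subspace hL)) => a x y xW yW.
  have [sx [fx sfx ex]] := hcf x xW; have [sy [fy sfy ey]] := hcf y yW.
  rewrite comb_linear; apply: combE => t tk.
  rewrite {1}ex {1}ey scalerDr addrACA !comb_linear cfU //; exact: small_linear.
have UE f f' : small f -> small f' -> U *m (comb k n f + comb k n' f') = comb k n' f.
  by move=> sf sf'; rewrite hU; [apply: combE => t tk; apply: cfU|apply: WD].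
have UL x s : L s x -> L s (U *m x).
  move=> Ls; have xW : W x by exists s.
  have [f [f' [sf sf' ex]]] := full x xW; rewrite ex UE //; rewrite ex in Ls.
  apply: (comb_transfer ho hn hn') => //; exact: orth2 Ls.
have Uc x : W x -> U *m (c *m x) = c *m (U *m x).
  move=> xW; have [f [f' [sf sf' ->]]] := full x xW.
  rewrite mulmxDr !comb_X // !UE ?comb_X // => t; exact: (size_modphi hAF).
exists (p' *m U) => x xW px; rewrite -!mulmxA.
have UW y : W y -> W (U *m y) by move=> [s hs]; exists s; apply: UL.
split; first by apply: pp'; apply: UW.
- move=> s; split=> [Ls|].
    by have := p'_int _ _ (UL _ _ Ls); rewrite addr0.
  move=> Ls; apply: contrapT => nLs.
  have x0 : x != 0 by apply/eqP => h; apply: nLs; rewrite h; apply: (fil0 hL).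
  have ho1 t := ordP hv hL t xW x0; set o := ord L x in ho1.
  have os : o < s by rewrite ltNge; apply/negP => /ho1.
  have Lo : L o x by apply/ho1.
  have [f [f' [sf sf' ex]]] := full x xW.
  have LC : L o (comb k n f) by rewrite ex in Lo; apply: orth2 Lo.
  have LC' : L o (comb k n' f').
    rewrite -(addKr (comb k n f) (comb k n' f')) -ex; apply: (filD hL) => //.
    exact: (filN hv hL).
  have p'x := projections_kill hpp xW px.
  (* As [p'] kills x, the component along [n'] has no leading term at level o. If the image of x
     were deeper than o, so would be the component along [n], by transferring it back from [n']. *)
  have C'1 : L (o + 1) (comb k n' f').
    have -> : comb k n' f' = - (p' *m comb k n' f' - comb k n' f') - p' *m comb k n f.
      rewrite opprB -addrA -opprD [p' *m _ + _]addrC -mulmxDr -ex p'x.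
      by rewrite subr0.
    apply: (filB hv hL); last exact: kill.
    by apply: (filN hv hL); apply: (proj_comb hg' ho' hn' sf' hp' LC').
  have UxE : U *m x = comb k n' f by rewrite {1}ex UE.
  have LUx : L o (comb k n' f) by rewrite -UxE; apply: UL.
  have Ux1 : L (o + 1) (comb k n' f).
    rewrite -[comb k n' f](subKr (p' *m comb k n' f)); apply: (filB hv hL).
      by rewrite -UxE; apply: (filW hL) Ls; lia.
    exact: (proj_comb hg' ho' hn' sf hp' LUx).
  have : L (o + 1) x.
    rewrite ex; apply: (filD hL) => //.
    by apply: (comb_transfer ho' hn' hn) => // t tk; rewrite hord.
  by move/ho1; lia.
- move=> s Ls.
  (* [U] commutes with [c] and [p'] with [b], so only the difference b - c survives, and it lies in
     a_{-r}. *)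
  have -> : p' *m (U *m (b *m x)) - b *m (p' *m (U *m x)) =
      p' *m (U *m ((b - c) *m x)) - p' *m ((b - c) *m (U *m x)).
    rewrite -pb; last exact: UW.
    rewrite !mulmxBl !mulmxBr Uc // opprB addrA subrK.
    by [].
  have h1 : L (s - r) ((b - c) *m x) by apply: hbc.
  have h2 : L (s - r) ((b - c) *m (U *m x)) by apply: hbc; apply: UL.
  apply: (filB hv hL).
    by have := p'_int _ _ (UL _ _ h1); rewrite addr0.
  by have := p'_int _ _ h2; rewrite addr0.
Qed.
End FieldFiltration.

(** * Recovering a filtration from its endomorphisms *)

Section Reconstruction.
Variables (F : fieldType) (v : F -> int) (pi : F).
Hypothesis hv : discrete_valuation v pi.
Variable m : nat.
Implicit Types M N : int -> 'cV[F]_m -> Prop.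

Lemma rank1_mul (x y : 'cV[F]_m) (xi : 'rV[F]_m) :
  x *m xi *m y = (xi *m y) 0 0 *: x.
Proof.
by rewrite -mulmxA {1}[xi *m y]mx11_scalar mul_mx_scalar.
Qed.

(** A form vanishing on the span of [M] gives rank one maps onto the line of [x] that vanish on that
    span, whatever their scaling. All of them shift [N] by at least [r], so [x] lies in every
    lattice of [N] and is 0. *)
Lemma span_incl e e' M N r x : filtration v e M -> filtration v e' N ->
  (forall a, (forall t, aset M t a) -> aset N r a) -> fspan N x -> fspan M x.
Proof.
move=> hM hN h [s hs]; apply: contrapT => nx.
have [xi [xiM xix]] := subspace_separate (fspan_subspace hM) nx.
suff x0 : x = 0 by apply: nx; rewrite x0; exists 0; apply: (fil0 hM).
apply: (fil_sep hv hN) => t.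
have [a a0 va] := val_surj hv (- `|t - s - r|).
have : aset N r (a *: (x *m xi)).
  apply: h => t' s' y hy; rewrite -scalemxAl rank1_mul.
  by rewrite xiM ?mxE ?scale0r ?scaler0; [apply: (fil0 hM)|exists s'].
move=> /(_ s x hs); rewrite -scalemxAl rank1_mul xix scale1r => hax.
have := filZ hN (invr_neq0 a0) hax; rewrite scalerA mulVf // scale1r.
apply: (filW hN); rewrite (val_V hv) // va opprK.
have e0 := fil_e hN; have := ler_norm (t - s - r).
have : `|t - s - r| <= e' * `|t - s - r| by rewrite ler_peMl.
by move: (e' * `|t - s - r|) `|t - s - r| => w u; lia.
Qed.

(** The constant [kappa] is the order of the form [xi]: the largest lower bound of e v(xi y) - ord
    y. *)
Lemma rank1_order e M x0 (xi : 'rV[F]_m) : filtration v e M ->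
  fspan M x0 -> (xi *m x0) 0 0 = 1 ->
  exists kappa, forall x t, fspan M x -> x != 0 ->
    aset M t (x *m xi) <-> t <= ord M x + kappa.
Proof.
move=> hM x0W xi0; have e0 := fil_e hM.
have nzy (y : 'cV[F]_m) : (xi *m y) 0 0 != 0 -> y != 0.
  by apply: contra => /eqP ->; rewrite mulmx0 mxE.
pose T k := forall y, fspan M y -> (xi *m y) 0 0 != 0 ->
  k <= e * v ((xi *m y) 0 0) - ord M y.
have [s1 hs1] := fil_form hM xi.
have [|k hk|kappa [Tk kmax]] := @int_has_max T (- ord M x0).
(* Scale y into the window of length e above [s1]. There the form has valuation at least 1, which
   makes up for the length of the window. *)
- exists (- s1) => y yW xiy.
  have [j [j1 j2]] : exists j, s1 <= ord M y + e * j /\ ord M y + e * j < s1 + e.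
    exists (- ((ord M y - s1) %/ e)%Z).
    have := divz_eq (ord M y - s1) e; have := modz_ge0 (ord M y - s1) (lt0r_neq0 e0).
    by have := ltz_pmod (ord M y - s1) e0; move: (divz _ _) (modz _ _) => d w; nia.
  have [b b0 vb] := val_surj hv j.
  have Ly : M s1 (b *: y).
    apply: (filW hM j1); rewrite -vb; apply: (filZ hM b0).
    by apply/(ordP hv hM _ yW (nzy _ xiy)).
  have := hs1 _ Ly; rewrite -scalemxAr mxE => /(vge_val (mulf_neq0 b0 xiy)).
  rewrite (val_M hv) // vb; move: (v _) (ord M y) j1 j2 => w o j1 j2; nia.
- by have := hk x0 x0W; rewrite xi0 (val_1 hv) oner_neq0 mulr0 sub0r; apply.
exists kappa => x t xW xn0; split=> h.
  suff : t - ord M x <= kappa by lia.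
  apply: kmax => y yW xiy.
  have Ly := (ordP hv hM (ord M y) yW (nzy _ xiy)).2 (lexx _).
  have := h _ _ Ly; rewrite rank1_mul.
  rewrite -(subrK (e * v ((xi *m y) 0 0)) (ord M y + t)) => /(filZK hv hM _ _ xiy).
  by move/(ordP hv hM _ xW xn0); lia.
move=> s y hy; rewrite rank1_mul.
have [->|xiy] := eqVneq ((xi *m y) 0 0) 0; first by rewrite scale0r; apply: (fil0 hM).
have yW : fspan M y by exists s.
have Lx := (ordP hv hM (ord M x) xW xn0).2 (lexx _).
apply: (filW hM) (filZ hM xiy Lx).
have := Tk y yW xiy; have := (ordP hv hM s yW (nzy _ xiy)).1 hy; lia.
Qed.

(* The rank one maps x xi in a_t(M) recover the order of x up to a constant. *)
Lemma filtration_shift e e' M N r r' : filtration v e M -> filtration v e' N ->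
  (exists x, fspan M x /\ x != 0) ->
  (forall (j : nat) a, aset M (- r - j%:Z) a <-> aset N (- r' - j%:Z) a) ->
  exists k0, forall s x, M s x <-> N (s + k0) x.
Proof.
move=> hM hN [x0 [x0W x0n]] h.
have h0 a : aset M (- r) a <-> aset N (- r') a.
  by have := h 0%N a; rewrite !subr0.
have MN x : fspan M x <-> fspan N x.
  split; first by apply: (span_incl hN hM (r := - r)) => a ha; apply/h0; apply: ha.
  by apply: (span_incl hM hN (r := - r')) => a ha; apply/h0; apply: ha.
have [xi [_ xi0]] : exists xi : 'rV[F]_m, (forall u : 'cV_m, u = 0 -> xi *m u = 0) /\
    (xi *m x0) 0 0 = 1.
  apply: (@subspace_separate F m (fun y => y = 0)); last exact/eqP.
  by split=> // [x1 y -> ->|a y ->]; rewrite ?addr0 ?scaler0.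
have [k hk] := rank1_order hM x0W xi0.
have [k' hk'] := rank1_order hN ((MN _).1 x0W) xi0.
(* The hypothesis sees only levels up to -r, so [x] is scaled until its rank one map lies strictly
   below -r; strictness keeps the next level visible. *)
have key x z : fspan M x -> x != 0 -> ord M x + k + e * z < - r ->
    ord N x + k' + e' * z = ord M x + k + e * z + r - r'.
  move=> xW xn0; have [b b0 vb] := val_surj hv z.
  have xN := (MN x).1 xW.
  have bx0 : b *: x != 0 by rewrite scaler_eq0 negb_or b0.
  have bW : fspan M (b *: x) by case: (fspan_subspace hM) => _ _; apply.
  have iffP t : t <= - r -> t <= ord M x + k + e * z <-> t + r - r' <= ord N x + k' + e' * z.
    move=> tr; have := h (absz (- r - t)) (b *: x *m xi).
    have -> : - r - `|(- r - t)%R|%N%:Z = t by lia.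
    have -> : - r' - `|(- r - t)%R|%N%:Z = t + r - r' by lia.
    rewrite hk // hk' //; last exact/MN.
    rewrite (ord_scale hv hM b0 xW xn0) (ord_scale hv hN b0 xN xn0) vb.
    by rewrite ![_ + _ * z + _]addrAC.
  move: iffP; move: (ord M x + k + e * z) (ord N x + k' + e' * z) => A B iffP lt.
  have := (iffP A (ltW lt)).1 (lexx _).
  have : ~ (A + 1 + r - r' <= B) by move/(iffP (A + 1) _).2; lia.
  lia.
have e0 := fil_e hM.
have ordN x : fspan M x -> x != 0 -> ord N x = ord M x + (k - k' + r - r').
  move=> xW xn0.
  set a := ord M x + k.
  (* Comparing two consecutive scalings gives e = e'; the constant shift follows. *)
  have [z [hz1 hz2]] : exists z : int, a + e * z < - r /\ a + e * (z - 1) < - r.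
    by exists (- (`|a| + `|r| + 1)); split; nia.
  have := key x z xW xn0 hz1; have := key x (z - 1) xW xn0 hz2; rewrite -/a /a.
  by rewrite !mulrBr !mulr1; nia.
exists (k - k' + r - r') => s x.
have [->|xn0] := eqVneq x 0.
  by split=> _; [apply: (fil0 hN)|apply: (fil0 hM)].
have [xW|nx] := pselect (fspan M x); last first.
  split=> hx; first by case: nx; exists s.
  by case: nx; apply/MN; exists (s + (k - k' + r - r')).
rewrite (ordP hv hM s xW xn0) (ordP hv hN _ ((MN x).1 xW) xn0) ordN //.
by rewrite lerD2r.
Qed.
End Reconstruction.

(** * Matched blocks *)

Section Strata.
Variables (F : fieldType) (v : F -> int) (pi : F).
Hypothesis hv : discrete_valuation v pi.

Lemma full_span m e (L : int -> 'cV[F]_m -> Prop) : filtration v e L ->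
  is_lattice v (L 0) m -> forall x, fspan L x.
Proof.
move=> hL [B [rB hB]] x.
have uB : B \in unitmx by rewrite -row_full_unit /row_full rB.
set y := invmx B *m x; have xE : x = B *m y by rewrite mulKVmx.
pose N := \sum_i `|v (y i 0)|.
have [a a0 va] := val_surj hv N.
suff La : L 0 (a *: x).
  have -> : x = a^-1 *: (a *: x) by rewrite scalerA mulVf // scale1r.
  by case: (fspan_subspace hL) => _ _; apply; exists 0.
apply/hB; exists (a *: y); rewrite -scalemxAr -xE; split=> // i; rewrite mxE.
have [->|yi] := eqVneq (y i 0) 0; first by rewrite mulr0; left.
right; rewrite (val_M hv) // va /N (bigD1 i) //=.
have : 0 <= \sum_(j | j != i) `|v (y j 0)| by apply: sumr_ge0.
by move: (\sum_(j | _) _) => S hS; lia.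
Qed.

Lemma restrict_filtration m e (L : int -> 'cV[F]_m -> Prop) P :
  filtration v e L -> filtration v e (restrict L P).
Proof.
move=> hL; split; first exact: (fil_e hL).
- by move=> s; split; [apply: (fil0 hL)|rewrite mulmx0].
- move=> s x y [hx px] [hy py]; split; first exact: (filD hL).
  by rewrite mulmxDr px py.
- by move=> s t x st [hx px]; split=> //; apply: (filW hL) hx.
- move=> s a x a0 [hx px]; split; first exact: (filZ hL).
  by rewrite -scalemxAr px.
- by move=> xi; have [s hs] := fil_form hL xi; exists s => x [/hs].
Qed.

Lemma extsum_filtration m e (L1 L2 : int -> 'cV[F]_m -> Prop) :
  filtration v e L1 -> filtration v e L2 -> filtration v e (extsum L1 L2).
Proof.
move=> h1 h2; split; first exact: (fil_e h1).
- by move=> s; split; rewrite linear0; [apply: (fil0 h1)|apply: (fil0 h2)].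
- move=> s x y [x1 x2] [y1 y2]; split; rewrite linearD /=;
  by [apply: (filD h1)|apply: (filD h2)].
- by move=> s t x st [x1 x2]; split; [apply: (filW h1) x1|apply: (filW h2) x2].
- move=> s a x a0 [x1 x2]; split; rewrite linearZ /=;
  by [apply: (filZ h1)|apply: (filZ h2)].
- move=> xi; have [s1 hs1] := fil_form h1 (lsubmx xi).
  have [s2 hs2] := fil_form h2 (rsubmx xi).
  exists (Num.max s1 s2) => x [x1 x2].
  rewrite -[xi]hsubmxK -[x]vsubmxK mul_row_col mxE; apply: (vgeD hv).
    by apply: hs1; apply: (filW h1) x1; rewrite le_max lexx.
  by apply: hs2; apply: (filW h2) x2; rewrite le_max lexx orbT.
Qed.

Lemma peval_zero m (f : {poly F}) : exists a, peval (0 : 'M[F]_m) f = a%:M.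
Proof.
elim/poly_ind: f => [|f a _]; first by exists 0; rewrite peval0 raddf0.
by exists a; rewrite pevalD pevalM pevalX mulmx0 add0r pevalC.
Qed.

(** For a zero stratum F[c] is F, acting by scalars, and these normalise any filtration. *)
Lemma simple_field m e (L : int -> 'cV[F]_m -> Prop) q r c :
  filtration v e L -> (exists x, fspan L x /\ x != 0) -> simple v pi L q r c ->
  gen_field L c /\ normalizes L c.
Proof.
move=> hL [x [[s hx] x0]] [_ [[-> _]|[[_ hf hn _ _] _]]]; last by [].
split.
  split; first by exists s, x.
  move=> f; have [a fa] := peval_zero m f; rewrite fa.
  have [->|a0] := eqVneq a 0.
    by left=> t y _; rewrite raddf0.
  right; exists a^-1%:P => t y _; rewrite pevalC -mulmxE -scalar_mxM mulVf //.
move=> f; have [a fa] := peval_zero m f; rewrite fa => na.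
have a0 : a != 0.
  by apply/eqP => a0; apply: na => t y _; rewrite a0 raddf0.
exists (e * v a) => t y; split=> [hy|[z [hz ->]]]; last first.
  by rewrite mul_scalar_mx; apply: (filZ hL).
exists (a^-1 *: y); rewrite mul_scalar_mx scalerA divff // scale1r; split=> //.
apply/(filZK hv hL t _ a0); by rewrite scalerA divff // scale1r.
Qed.

Lemma simple_good m e (L : int -> 'cV[F]_m -> Prop) q r c x :
  filtration v e L -> simple v pi L q r c ->
  aset L 0 x -> aset L (- r) (x *m c - c *m x) ->
  forall f, nz L c f -> good L c x f.
Proof.
move=> hL hs hx hxc; have [[c0 qr]|nz0] := pselect (zero_stratum q r c).
  move=> f _; have [a fa] := peval_zero m f.
  rewrite /good /comm c0 fa scalar_mxC subrr; exact: (aset0 hL).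
exact: (simple_commutation hv hL hs nz0).
Qed.

Lemma indep_map m1 m2 (L1 L1' : 'cV[F]_m1 -> Prop) (L2 L2' : 'cV[F]_m2 -> Prop)
  (phi : 'M[F]_(m2, m1)) (D : 'cV[F]_m1 -> Prop) l :
  subspace D -> (forall x, L1 x -> D x) -> (forall x, L1 x -> L2 (phi *m x)) ->
  (forall x, D x -> L2' (phi *m x) -> L1' x) ->
  indep v L1 L1' l -> indep v L2 L2' l.
Proof.
move=> hD h1 h2 h3 [y [hy hi]]; exists (fun t => phi *m y t); split.
  by move=> t tl; apply: h2; apply: hy.
move=> a ao ha; apply: hi => //; apply: h3.
  apply: subspace_sum => // t _; have [_ _ DZ] := hD.
  by apply: DZ; apply: h1; apply: hy.
rewrite mulmx_sumr; suff -> : \sum_(i < l) phi *m (a i *: y i) =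
  \sum_(t < l) a t *: (phi *m y t) by [].
by apply: eq_bigr => t _; rewrite scalemxAr.
Qed.

Lemma fix_subspace m (p : 'M[F]_m) : subspace (fun x => p *m x = x).
Proof.
split; first by rewrite mulmx0.
  by move=> x y px py; rewrite mulmxDr px py.
by move=> a x px; rewrite -scalemxAr px.
Qed.

Section Blocks.
Variables (n : nat) (e : int) (Lam : int -> 'cV[F]_n -> Prop).
Hypothesis hLam : filtration v e Lam.
Hypothesis full : forall x, fspan Lam x.
Variables (P P' : 'M[F]_n).
Local Notation M := (extsum (restrict Lam P) (restrict Lam P')).
Local Notation pr := (block_mx 1%:M 0 0 0 : 'M[F]_(n + n)).
Local Notation pr' := (block_mx 0 0 0 1%:M : 'M[F]_(n + n)).

Lemma prE (x y : 'cV[F]_n) : pr *m col_mx x y = col_mx x 0.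
Proof. by rewrite mul_block_col !mul0mx mul1mx !addr0. Qed.
Lemma prE' (x y : 'cV[F]_n) : pr' *m col_mx x y = col_mx 0 y.
Proof. by rewrite mul_block_col !mul0mx mul1mx !add0r. Qed.

Lemma extsumE s (x y : 'cV[F]_n) : M s (col_mx x y) <-> restrict Lam P s x /\ restrict Lam P' s y.
Proof. by rewrite /extsum col_mxKu col_mxKd. Qed.

Lemma restrict0 s Q : restrict Lam Q s 0.
Proof. by split; [apply: (fil0 hLam)|rewrite mulmx0]. Qed.

Lemma matched_block b b' qq r (L : int -> 'cV[F]_(n + n) -> Prop) q'' r'' c :
  P *m P = P -> P != 0 -> P *m b *m P = b -> P' *m b' *m P' = b' ->
  simple v pi L q'' r'' c ->
  equiv_strata M qq r (block_mx b 0 0 b') L q'' r'' c ->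
  (forall s k, kdim v (restrict Lam P s) (restrict Lam P (s + 1)) k <->
     kdim v (restrict Lam P' s) (restrict Lam P' (s + 1)) k) ->
  exists G : 'M[F]_n, forall x, P *m x = x ->
    [/\ P' *m (G *m x) = G *m x, forall s, Lam s x <-> Lam s (G *m x) &
        forall s, Lam s x -> Lam (s - r) (G *m (b *m x) - b' *m (G *m x))].
Proof.
move=> PP Pn0 Pb Pb' hsimple heq hkd.
have hM : filtration v e M by apply: extsum_filtration; apply: restrict_filtration.
have [e'' hL] : exists e, filtration v e L.
  by apply: (lattice_seq_filtration hv); case: hsimple => -[].
set B := block_mx b 0 0 b' in heq.
have [x0 [x0M x0n]] : exists x, fspan M x /\ x != 0.
  have [j hj] : exists j, col j P != 0.
    apply: contrapT => h; case/eqP: Pn0; apply/matrixP => i j.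
    have /eqP : col j P = 0 by apply/eqP; apply: contraT => hj; case: h; exists j.
    by move/eqP/colP/(_ i); rewrite !mxE.
  exists (col_mx (col j P) 0); split; last first.
    by apply: contra hj => /eqP h; rewrite -[col j P](col_mxKu _ (0 : 'cV_n)) h linear0.
  have [s hs] := full (col j P); exists s; apply/extsumE; split; last exact: restrict0.
  by split=> //; rewrite colE mulmxA PP.
have cB : aset L (- r'') (c - B) /\ aset M (- r) (c - B).
  have h1 := heq 0%N B; have h2 := heq 0%N c; rewrite !subr0 in h1 h2; split.
    rewrite -opprB; apply: (asetN hv hL); apply/h1; rewrite subrr; exact: (aset0 hM).
  by apply/h2; rewrite subrr; apply: (aset0 hL).
(* Equivalence speaks of cosets of [B] and [c]; since c - B lies in the lattices at hand, the
   lattices themselves coincide. *)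
have hset (j : nat) a : aset M (- r - j%:Z) a <-> aset L (- r'' - j%:Z) a.
  have := heq j (a + B); rewrite addrK => ->.
  have cBj : aset L (- r'' - j%:Z) (c - B) by apply: (asetW hL) cB.1; lia.
  split=> h.
    have -> : a = (a + B - c) + (c - B) by rewrite addrA subrK addrK.
    exact: (asetD hL).
  have -> : a + B - c = a - (c - B) by rewrite opprB addrA.
  exact: (asetB hv hL).
have [k0 hk0] := filtration_shift hv hM hL (ex_intro _ x0 (conj x0M x0n)) hset.
have asetML t a : aset M t a <-> aset L t a.
  split=> h s x.
    have := h (s - k0) x; rewrite !hk0 subrK.
    by have -> : s - k0 + t + k0 = s + t by lia.
  have := h (s + k0) x; rewrite !hk0.
  by have -> : s + t + k0 = s + k0 + t by lia.
have spanML x : fspan M x <-> fspan L x.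
  split=> [[s /hk0 hs]|[s hs]]; first by exists (s + k0).
  by exists (s - k0); apply/hk0; rewrite subrK.
have [c_field c_norm] := simple_field hL
  (ex_intro _ x0 (conj ((spanML _).1 x0M) x0n)) hsimple.
have MP s x : M s x -> P *m usubmx x = usubmx x /\ P' *m dsubmx x = dsubmx x.
  by move=> [[_ h1] [_ h2]].
have prM : aset M 0 pr.
  move=> s x; rewrite addr0 -[x]vsubmxK => /extsumE[h1 _]; rewrite prE.
  by apply/extsumE; split=> //; apply: restrict0.
have prM' : aset M 0 pr'.
  move=> s x; rewrite addr0 -[x]vsubmxK => /extsumE[_ h1]; rewrite prE'.
  by apply/extsumE; split=> //; apply: restrict0.
have hproj : projections L pr pr'.
  split; [exact/asetML|exact/asetML| | |] => x _; rewrite -[x]vsubmxK.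
  - by rewrite prE prE' add_col_mx addr0 add0r.
  - by rewrite !prE.
  - by rewrite !prE'.
have prB : pr *m B = B *m pr.
  by rewrite !mulmx_block !mul0mx !mulmx0 !mul1mx !mulmx1 ?addr0 ?add0r.
have prB' : pr' *m B = B *m pr'.
  by rewrite !mulmx_block !mul0mx !mulmx0 !mul1mx !mulmx1 ?addr0 ?add0r.
(* [pr] commutes exactly with the block diagonal [B], so its commutator with [c] is that with c - B
   and lies in a_{-r''}. *)
have hgood : forall f, nz L c f -> good L c pr f.
  apply: (simple_good hL hsimple); first exact/asetML.
  have -> : pr *m c - c *m pr = pr *m (c - B) - (c - B) *m pr.
    by rewrite mulmxBr mulmxBl prB opprB addrA subrK.
  have prL : aset L 0 pr by apply/asetML.
  apply: (asetB hv hL); first by rewrite -[- r'']add0r; apply: asetM => //; case: cB.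
  by rewrite -[- r'']addr0; apply: asetM => //; case: cB.
(* The shift by [k0] identifies the graded pieces of the two images inside [L] with those of the two
   blocks, where the dimensions agree by hypothesis. *)
have hindep s l : indep v (restrict L pr s) (restrict L pr (s + 1)) l <->
    indep v (restrict L pr' s) (restrict L pr' (s + 1)) l.
  have fixpr (x : 'cV_(n + n)) : pr *m x = x -> x = col_mx (usubmx x) 0.
    by move=> h; rewrite -{1}h -{1}[x]vsubmxK prE.
  have fixpr' (x : 'cV_(n + n)) : pr' *m x = x -> x = col_mx 0 (dsubmx x).
    by move=> h; rewrite -{1}h -{1}[x]vsubmxK prE'.
  have usubE (x : 'cV[F]_(n + n)) : row_mx 1%:M 0 *m x = usubmx x.
    by rewrite -{1}[x]vsubmxK mul_row_col mul1mx mul0mx addr0.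
  have dsubE (x : 'cV[F]_(n + n)) : row_mx 0 1%:M *m x = dsubmx x.
    by rewrite -{1}[x]vsubmxK mul_row_col mul1mx mul0mx add0r.
  have Ls x : L s x <-> M (s - k0) x by rewrite hk0 subrK.
  have Ls1 x : L (s + 1) x <-> M (s - k0 + 1) x.
    by rewrite hk0; have -> : s - k0 + 1 + k0 = s + 1 by lia.
  set s' := s - k0 in Ls Ls1.
  have toP : indep v (restrict L pr s) (restrict L pr (s + 1)) l ->
      indep v (restrict Lam P s') (restrict Lam P (s' + 1)) l.
    apply: (indep_map (phi := row_mx 1%:M 0) (fix_subspace pr)); first by move=> x [].
      by move=> x [/Ls[h _] _]; rewrite usubE.
    move=> x px; rewrite usubE => hx; split=> //; apply/Ls1; rewrite (fixpr _ px).
    by apply/extsumE; split=> //; apply: restrict0.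
  have toP' : indep v (restrict L pr' s) (restrict L pr' (s + 1)) l ->
      indep v (restrict Lam P' s') (restrict Lam P' (s' + 1)) l.
    apply: (indep_map (phi := row_mx 0 1%:M) (fix_subspace pr')); first by move=> x [].
      by move=> x [/Ls[_ h] _]; rewrite dsubE.
    move=> x px; rewrite dsubE => hx; split=> //; apply/Ls1; rewrite (fixpr' _ px).
    by apply/extsumE; split=> //; apply: restrict0.
  have colE (x : 'cV[F]_n) : col_mx 1%:M 0 *m x = col_mx x 0.
    by rewrite mul_col_mx mul1mx mul0mx.
  have colE' (x : 'cV[F]_n) : col_mx 0 1%:M *m x = col_mx 0 x.
    by rewrite mul_col_mx mul1mx mul0mx.
  have ofP : indep v (restrict Lam P s') (restrict Lam P (s' + 1)) l ->
      indep v (restrict L pr s) (restrict L pr (s + 1)) l.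
    apply: (indep_map (phi := col_mx 1%:M 0) (fix_subspace P)); first by move=> x [].
      move=> x hx; rewrite colE; split; last exact: prE.
      by apply/Ls/extsumE; split=> //; apply: restrict0.
    by move=> x px; rewrite colE => -[/Ls1/extsumE[]].
  have ofP' : indep v (restrict Lam P' s') (restrict Lam P' (s' + 1)) l ->
      indep v (restrict L pr' s) (restrict L pr' (s + 1)) l.
    apply: (indep_map (phi := col_mx 0 1%:M) (fix_subspace P')); first by move=> x [].
      move=> x hx; rewrite colE'; split; last exact: prE'.
      by apply/Ls/extsumE; split=> //; apply: restrict0.
    by move=> x px; rewrite colE' => -[/Ls1/extsumE[]].
  split=> h; [apply: ofP'|apply: ofP].
    by apply: (equal_kdim_indep hv (restrict_residue hLam P s')) (toP h) => k /hkd.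
  by apply: (equal_kdim_indep hv (restrict_residue hLam P' s')) (toP' h) => k /hkd.
have [rho [phi [hAF hphi]]] := min_poly_almost_field hL c_field c_norm.
(* The bound -r is read off on [M], where c - B lies in a_{-r}; the shift by [k0] does not affect
   lattices of endomorphisms, so it holds on [L] whatever r'' is. *)
have BcL : aset L (- r) (B - c).
  by apply/asetML; rewrite -opprB; apply: (asetN hv hM); case: cB.
have BW x : fspan L x -> fspan L (B *m x).
  move=> xW; have -> : B *m x = (B - c) *m x + c *m x by rewrite mulmxBl subrK.
  have [_ WD _] := fspan_subspace hL; apply: WD.
    by have [s hs] := xW; exists (s + - r); apply: BcL.
  by rewrite -[c](pevalX c); apply: (peval_span hL c_norm).
have [|G hG] := isometry_ex hv hL c_field c_norm hAF hphi hproj hgood hindep BcL _ BW.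
  by move=> x _; rewrite !mulmxA prB'.
(* The isometry carries the first summand into the second, so only its lower left block matters. *)
exists (dsubmx (G *m col_mx 1%:M 0)) => x Px.
have GE y : dsubmx (G *m col_mx 1%:M 0) *m y = dsubmx (G *m col_mx y 0).
  by rewrite mul_dsub_mx -mulmxA mul_col_mx mul1mx mul0mx.
have lift s y : P *m y = y -> Lam s y <-> M s (col_mx y 0).
  move=> Py; rewrite extsumE; split=> [h|[[]]] //; split; [by split|exact: restrict0].
have liftL y : P *m y = y -> fspan L (col_mx y 0).
  by move=> Py; apply/spanML; have [s hs] := full y; exists s; apply/lift.
have [h1 h2 h3] := hG _ (liftL x Px) (prE x 0).
set z := G *m col_mx x 0 in h1 h2 h3.
have zE : z = col_mx 0 (dsubmx z) by rewrite -{1}h1 -{1}[z]vsubmxK prE'.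
have Gx s : Lam s x <-> M s z by rewrite lift // !hk0 h2.
have zP' : P' *m dsubmx z = dsubmx z.
  by have [s hs] := full x; have [] := MP s z ((Gx s).1 hs).
rewrite !GE -/z; split=> //.
  move=> s; rewrite Gx {1}zE extsumE; split=> [[_ []]|h] //; split; first exact: restrict0.
  by split.
move=> s hs.
have Pbx : P *m (b *m x) = b *m x by rewrite -{1}Pb -!mulmxA (mulmxA P) PP !mulmxA Pb.
have := h3 (s + k0) ((hk0 s _).1 ((lift s x Px).1 hs)).
have -> : s + k0 - r = s - r + k0 by lia.
rewrite -hk0 mul_block_col !mul0mx mulmx0 !addr0 zE mul_block_col !mul0mx mulmx0 !add0r.
by case=> _ [h _]; move: h; rewrite linearB /= !col_mxKd.
Qed.
End Blocks.
End Strata.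

(** * Gluing the block isometries *)

Unset Implicit Arguments.

Theorem theorem8p2 (F : fieldType) (v : F -> int) (pi : F) (n : nat)
  (Lam : int -> 'cV[F]_n -> Prop) (q r : int) (b b' : 'M[F]_n)
  (I I' : finType) (P : I -> 'M[F]_n) (P' : I' -> 'M[F]_n) (zeta : I -> I') :
  local_field v pi ->
  full_lattice_seq v pi Lam ->
  semisimple_split v pi Lam q r b P ->
  semisimple_split v pi Lam q r b' P' ->
  intertwine Lam q r b Lam q r b' ->
  is_matching v pi Lam r b P Lam b' P' zeta ->
  (forall (i : I) (j : int) (k : nat),
     kdim v (restrict Lam (P i) j) (restrict Lam (P i) (j + 1)) k <->
     kdim v (restrict Lam (P' (zeta i)) j) (restrict Lam (P' (zeta i)) (j + 1)) k) ->
  exists g : 'M[F]_n, in_Ut Lam g /\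
    equiv_strata Lam q r (g *m b *m invmx g) Lam q r b'.
Proof.
move=> [hv _ _ _] [hseq hfull] hb hb' _ [zbij hmatch] hkd.
have [_ [Pn0 PP Porth Psum] Pdiag PLam [qs [hqs _ _]]] := hb.
have [_ [P'n0 P'P' P'orth P'sum] P'diag P'LamI [qs' [hqs' _ _]]] := hb'.
have [e hLam] := lattice_seq_filtration hv hseq.
have full := full_span hv hLam (hfull 0).
have [zinv zK Kz] := zbij.
have conj (Q a : 'M[F]_n) : Q * Q = Q -> Q *m (Q * a * Q) *m Q = Q * a * Q.
  by move=> QQ; rewrite !mulmxE !mulrA QQ -mulrA QQ.
have /choice[G hG] : forall i, exists G : 'M[F]_n, forall x : 'cV[F]_n, P i *m x = x ->
    [/\ P' (zeta i) *m (G *m x) = G *m x, forall s, Lam s x <-> Lam s (G *m x) &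
        forall s, Lam s x -> Lam (s - r)
          (G *m ((P i * b * P i) *m x)
           - (P' (zeta i) * b' * P' (zeta i)) *m (G *m x))].
  move=> i.
  have [L [q'' [r'' [c [hsimple heq]]]]] := hmatch i _ _ (hqs i) (hqs' (zeta i)).
  apply: (matched_block hv hLam full _ _ _ _ hsimple heq (hkd i)) => //.
  - exact: PP.
  - by apply: conj.
  - by apply: conj.
pose g := \sum_i G i *m P i.
have fixP i (x : 'cV[F]_n) : P i *m (P i *m x) = P i *m x by rewrite mulmxA [P i *m P i]PP.
(* [g] carries the block of [i] into the block of [zeta i], and injectivity of [zeta] keeps the
   other blocks out; all later claims can thus be checked block by block. *)
have gP i (x : 'cV[F]_n) : P' (zeta i) *m (g *m x) = G i *m (P i *m x).
  rewrite mulmx_suml mulmx_sumr (bigD1 i) //= big1 ?addr0.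
    by have [h _ _] := hG i _ (fixP i x); rewrite -!mulmxA.
  move=> j ji; have [h _ _] := hG j _ (fixP j x).
  rewrite -!mulmxA -h mulmxA.
  have -> : P' (zeta i) *m P' (zeta j) = 0.
    by apply: P'orth; apply: contra ji => /eqP/(can_inj zK) ->; exact: eqxx.
  by rewrite mul0mx.
have LamP s x : (forall i, Lam s (P i *m x)) -> Lam s x.
  move=> h; rewrite -[x]mul1mx -[1%:M]Psum mulmx_suml.
  by apply: (fil_sum hLam) => i _; apply: h.
have LamP' s x : (forall i, Lam s (P' (zeta i) *m x)) -> Lam s x.
  move=> h; rewrite -[x]mul1mx -[1%:M]P'sum mulmx_suml.
  (* Surjectivity of [zeta] brings every index of the second splitting into the form [zeta i]. *)
  by apply: (fil_sum hLam) => i _; rewrite -[i]Kz; apply: h.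
have gLam s x : Lam s x <-> Lam s (g *m x).
  split=> h.
    apply: LamP' => i; rewrite gP; have [_ hi _] := hG i _ (fixP i x).
    by apply/hi; apply: PLam.
  apply: LamP => i; have [_ hi _] := hG i _ (fixP i x).
  by apply/hi; rewrite -gP; apply: P'LamI.
have ginj (x : 'cV[F]_n) : g *m x = 0 -> x = 0.
  move=> h; apply: (fil_sep hv hLam) => s; apply/gLam; rewrite h; exact: (fil0 hLam).
have gu : g \in unitmx.
  rewrite -unitmx_tr -row_free_unit -kermx_eq0; apply/eqP/row_matrixP => i.
  rewrite row0; apply: trmx_inj; rewrite trmx0; apply: ginj.
  apply: trmx_inj; rewrite trmx_mul trmxK -row_mul mulmx_ker.
  by rewrite row0 trmx0.
exists g; split.
  split=> // s x; rewrite addr0; first by move/gLam.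
  by move=> h; apply/gLam; rewrite mulKVmx.
(* Both b and b' are block diagonal for their splittings, so the component at [zeta i] of the
   difference is the one bounded by the block isometry [G i]. *)
have key : aset Lam (- r) (g *m b - b' *m g).
  move=> s x hx; apply: LamP' => i.
  have [_ _ h] := hG i _ (fixP i x); have := h s (PLam s x i hx).
  have offd (J : finType) (Q : J -> 'M[F]_n) (a : 'M[F]_n) (j : J) :
      \sum_j Q j = 1 -> (forall j k, j != k -> Q j * a * Q k = 0) ->
      Q j *m a = Q j * a * Q j.
    move=> Qs Qd; rewrite -[LHS]mulmx1 -[1%:M]Qs mulmx_sumr (bigD1 j) //= big1 ?addr0 //.
    by move=> k; rewrite eq_sym => /Qd.
  have e1 : (P i * b * P i) *m (P i *m x) = P i *m (b *m x).
    by rewrite [RHS]mulmxA (offd _ _ _ i Psum Pdiag) mulmxA mulmxE -[_ * P i * P i]mulrA PP.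
  have e2 : (P' (zeta i) * b' * P' (zeta i)) *m (G i *m (P i *m x)) =
      P' (zeta i) *m (b' *m (g *m x)).
    rewrite -gP [RHS]mulmxA (offd _ _ _ _ P'sum P'diag) mulmxA mulmxE.
    by rewrite -[_ * P' _ * P' _]mulrA P'P'.
  by rewrite e1 e2 mulmxBl mulmxBr -!mulmxA gP.
have gb : aset Lam (- r) (g *m b *m invmx g - b').
  move=> s x hx; have hx' : Lam s (invmx g *m x) by apply/gLam; rewrite mulKVmx.
  have := key _ _ hx'; rewrite !mulmxBl -!mulmxA mulKVmx //.
move=> j a; have gbj : aset Lam (- r - j%:Z) (g *m b *m invmx g - b').
  by apply: (asetW hLam) gb; lia.
split=> h.
  have -> : a - b' = (a - g *m b *m invmx g) + (g *m b *m invmx g - b').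
    by rewrite addrA subrK.
  exact: (asetD hLam).
have -> : a - g *m b *m invmx g = (a - b') - (g *m b *m invmx g - b').
  by rewrite opprB addrA subrK.
exact: (asetB hv hLam).
Qed.
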